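(* Let $G$ be a locally compact second countable group and let $\mu$ be a probability measure on $G$ that is equivalent to the Haar measure. Let $K \le G$ be an invariant random subgroup. If the Furstenberg-Poisson boundary of the $\mu$-random walk on $K\backslash G$ is almost surely trivial, then $K$ is almost surely co-amenable in $G$.
   Context: $\mathrm{Sub}_G$ is the compact metrizable space of closed subgroups of $G$ with the Chabauty topology; $G$ acts on it continuously by conjugation. An invariant random subgroup (IRS) of $G$ is a random variable $K$ with values in $\mathrm{Sub}_G$ whose law is a conjugation-invariant Borel probability measure. Equivalent measures means mutually absolutely continuous. Let $h_1,h_2,\dots$ be i.i.d. with law $\mu$ and $g_n = h_1h_2\cdots h_n$. For $H\in \mathrm{Sub}_G$, the $\mu$-random walk on $H\backslash G$ is the process $(Hg_1,Hg_2,\dots)$. Its Furstenberg-Poisson boundary is Mackey's point realization of the $\sigma$-algebra of shift-invariant events on $(H\backslash G)^{\mathbb N}$ with respect to the law of this process; it is trivial if every shift-invariant event has probability $0$ or $1$. A closed subgroup $H$ of $G$ is co-amenable in $G$ if there is a $G$-invariant mean on $G/H$ (i.e. on $L^\infty(G/H)$ with respect to the $G$-invariant measure class on $G/H$). *)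

(* Defs.v *)
From HB Require Import structures.
From mathcomp Require Import all_boot all_order all_algebra finmap.
From mathcomp Require Import all_classical all_reals all_analysis.

Set Implicit Arguments.
Unset Strict Implicit.
Unset Printing Implicit Defensive.

Import Order.TTheory GRing.Theory Num.Theory.
Import numFieldNormedType.Exports.

Local Open Scope classical_set_scope.
Local Open Scope ring_scope.
Local Open Scope quotient_scope.

HB.mixin Record isTopologicalGroup G & PointedTopological G & Group G := {
  mulg_continuous : continuous (fun x : G * G => (x.1 * x.2)%g) ;
  invg_continuous : continuous (fun x : G => (x^-1)%g)
}.

(* The distinguished point is there only because the measurable types of the
   library are pointed; nothing is assumed about it. *)
#[short(type="topGroupType")]
HB.structure Definition TopologicalGroup :=
  {G of PointedTopological G & Group G & isTopologicalGroup G}.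

Notation borel T := (g_sigma_algebraType (@open T)).

Section haar_measure.
Context (R : realType) (G : topGroupType).

(* On a locally compact second countable Hausdorff group a Borel measure that
   is finite on compact sets is automatically regular. *)
Definition is_left_haar (m : {measure set (borel G) -> \bar R}) :=
  [/\ m [set: G] != 0%E,
      forall C : set G, compact C -> (m C < +oo)%E
    & forall (g : G) (A : set (borel G)), measurable A ->
        m [set (g * x)%g | x in A] = m A].

Definition equivalent_measures d (T : measurableType d)
    (m1 m2 : {measure set T -> \bar R}) := m1 `<< m2 /\ m2 `<< m1.

End haar_measure.

Section closed_subgroups.
Variable G : topGroupType.

Record closedSubgroup := ClosedSubgroup {
  csg_set :> set G ;
  csg_closed : closed csg_set ;
  csg1 : csg_set 1%g ;
  csgM : forall x y, csg_set x -> csg_set y -> csg_set (x * y)%g ;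
  csgV : forall x, csg_set x -> csg_set (x^-1)%g
}.

HB.instance Definition _ := gen_eqMixin closedSubgroup.
HB.instance Definition _ := gen_choiceMixin closedSubgroup.

Definition csgT : closedSubgroup :=
  @ClosedSubgroup setT (@closedT G) I (fun _ _ _ _ => I) (fun _ _ => I).
HB.instance Definition _ := isPointed.Build closedSubgroup csgT.

(* Subbase of the Chabauty topology: the sets of closed subgroups meeting a
   given open set, index (true, U), and of those avoiding a given compact set,
   index (false, C). *)
Definition chabauty_dom : set (bool * set G) :=
  [set i | if i.1 then open i.2 else compact i.2].
Definition chabauty_subbase (i : bool * set G) : set closedSubgroup :=
  [set H | if i.1 then csg_set H `&` i.2 !=set0 else csg_set H `&` i.2 = set0].

HB.instance Definition _ :=
  isSubBaseTopological.Build closedSubgroup chabauty_dom chabauty_subbase.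

Section conjugate.
Variables (g : G) (H : closedSubgroup).
Local Open Scope group_scope.

(* In the library x ^ g is g^-1 * x * g, so this set is g H g^-1. *)
Definition conj_set : set G := [set x | csg_set H (x ^ g)].

Let conj_closed : closed conj_set.
Proof.
have cM (f h : G -> G) : continuous f -> continuous h ->
    continuous (fun x => f x * h x).
  move=> cf ch x; apply: (@continuous_comp _ _ _ (fun x => (f x, h x))
    (fun x : G * G => x.1 * x.2)); last exact: mulg_continuous.
  by apply: cvg_pair; [exact: cf|exact: ch].
apply: (@closed_comp _ _ (fun x : G => x ^ g)); last exact: csg_closed.
move=> x _; apply: (cM (cst g^-1) (fun x => x * g)) => [y|]; first exact: cvg_cst.
by apply: cM => y; [exact: cvg_id|exact: cvg_cst].
Qed.

Let conj1 : conj_set 1.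
Proof. by rewrite /conj_set /= conj1g; exact: csg1. Qed.

Let conjM x y : conj_set x -> conj_set y -> conj_set (x * y).
Proof. by rewrite /conj_set /= conjMg; exact: csgM. Qed.

Let conjV x : conj_set x -> conj_set x^-1.
Proof. by rewrite /conj_set /= conjVg; exact: csgV. Qed.

Definition csg_conj : closedSubgroup :=
  ClosedSubgroup conj_closed conj1 conjM conjV.

End conjugate.
End closed_subgroups.

(* K is a random closed subgroup, defined on the probability space (T, P). *)
Definition is_IRS (R : realType) (G : topGroupType) d (T : measurableType d)
    (P : probability T R) (K : {mfun T >-> borel (closedSubgroup G)}) :=
  forall (g : G) (A : set (borel (closedSubgroup G))), measurable A ->
    distribution P K (csg_conj g @^-1` A) = distribution P K A.

Section coset_spaces.
Context (G : topGroupType) (H : closedSubgroup G).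
Local Open Scope group_scope.

Definition lcoset_rel : rel G := fun x y => `[< csg_set H (x^-1 * y) >].
Definition rcoset_rel : rel G := fun x y => `[< csg_set H (x * y^-1) >].

Let lcoset_refl : reflexive lcoset_rel.
Proof. by move=> x; apply/asboolP; rewrite mulVg; exact: csg1. Qed.
Let lcoset_sym : symmetric lcoset_rel.
Proof.
by move=> x y; apply/asboolP/asboolP => /csgV; rewrite invgM invgK.
Qed.
Let lcoset_trans : transitive lcoset_rel.
Proof.
move=> y x z /asboolP xy /asboolP yz; apply/asboolP.
by have := csgM xy yz; rewrite mulgA mulgK.
Qed.
Canonical lcoset_equiv :=
  EquivRel lcoset_rel lcoset_refl lcoset_sym lcoset_trans.

Let rcoset_refl : reflexive rcoset_rel.
Proof. by move=> x; apply/asboolP; rewrite mulgV; exact: csg1. Qed.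
Let rcoset_sym : symmetric rcoset_rel.
Proof.
by move=> x y; apply/asboolP/asboolP => /csgV; rewrite invgM invgK.
Qed.
Let rcoset_trans : transitive rcoset_rel.
Proof.
move=> y x z /asboolP xy /asboolP yz; apply/asboolP.
by have := csgM xy yz; rewrite mulgA mulgVK.
Qed.
Canonical rcoset_equiv :=
  EquivRel rcoset_rel rcoset_refl rcoset_sym rcoset_trans.

(* G / H, the space of the cosets xH, and H \ G, the space of the cosets Hx,
   with the quotient topology. *)
Definition lcoset_space := quotient_topology {eq_quot lcoset_equiv}.
HB.instance Definition _ := PointedTopological.on lcoset_space.
HB.instance Definition _ := Quotient.on lcoset_space.
Definition rcoset_space := quotient_topology {eq_quot rcoset_equiv}.
HB.instance Definition _ := PointedTopological.on rcoset_space.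
HB.instance Definition _ := Quotient.on rcoset_space.

Definition lact (g : G) (q : lcoset_space) : lcoset_space :=
  \pi_lcoset_space (g * repr q).

Lemma lact_pi g x : lact g (\pi_lcoset_space x) = \pi_lcoset_space (g * x).
Proof.
rewrite /lact; case: piP => y /eqquotP /asboolP xy.
apply/eqquotP/asboolP; rewrite invgM -mulgA mulKg.
by have := csgV xy; rewrite invgM invgK.
Qed.

End coset_spaces.

Section random_walk.
Context (R : realType) (G : topGroupType).

Definition mutually_independent d (T : measurableType d) (P : probability T R)
    (h : nat -> {mfun T >-> borel G}) :=
  forall (J : {fset nat}) (A : nat -> set (borel G)),
    (forall i, i \in J -> measurable (A i)) ->
    P (\bigcap_(i in [set` J]) (h i @^-1` A i)) =
    (\prod_(i <- J) P (h i @^-1` A i))%E.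

Definition is_iid d (T : measurableType d) (P : probability T R)
    (mu : probability (borel G) R) (h : nat -> {mfun T >-> borel G}) :=
  mutually_independent P h /\
  forall n (A : set (borel G)), measurable A -> distribution P (h n) A = mu A.

Variable H : closedSubgroup G.

Definition cylinders : set (set (nat -> rcoset_space H)) :=
  [set A | exists n (B : set (borel (rcoset_space H))),
     measurable B /\ A = [set x | B (x n)]].

Notation trajectories := (g_sigma_algebraType cylinders).

Definition shift (x : trajectories) : trajectories := fun n => x n.+1.

(* Indices are shifted by one: the increment h_(i+1) is [h i], and the n-th term
   of the trajectory is H h_1 ... h_(n+1). *)
Definition coset_walk d (T : measurableType d) (h : nat -> {mfun T >-> borel G})
    (w : T) : trajectories :=
  fun n => \pi_(rcoset_space H) (\prod_(i < n.+1) (h i w : G))%g.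

Definition trivial_boundary d (T : measurableType d) (P : probability T R)
    (h : nat -> {mfun T >-> borel G}) :=
  forall E : set trajectories, measurable E -> shift @^-1` E = E ->
    pushforward P (coset_walk h) E = 0%E \/
    pushforward P (coset_walk h) E = 1%E.

End random_walk.

Section coamenability.
Context (R : realType) (G : topGroupType) (H : closedSubgroup G).
Local Notation X := (lcoset_space H).

(* A sigma-finite measure representing the G-invariant measure class on G / H,
   i.e., nonzero and quasi-invariant. For G locally compact and second countable
   it exists and is unique up to equivalence. *)
Definition invariant_class (nu : {measure set (borel X) -> \bar R}) :=
  [/\ nu [set: X] != 0%E, sigma_finite [set: borel X] nu
    & forall (g : G) (A : set (borel X)), measurable A ->
        nu (lact g @^-1` A) = 0%E <-> nu A = 0%E].

(* A mean on L^oo(nu), as a functional on the representatives that depends only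
   on their classes; its values outside L^oo(nu) are irrelevant. *)
Definition is_mean (nu : {measure set (borel X) -> \bar R})
    (m : (borel X -> R) -> R) :=
  [/\ {in Lfun nu +oo%E &, forall f1 f2, f1 = f2 %[ae nu] -> m f1 = m f2},
      {in Lfun nu +oo%E &, forall f1 f2, forall a : R,
         m (fun x => a * f1 x + f2 x) = a * m f1 + m f2},
      {in Lfun nu +oo%E, forall f, (\forall x \ae nu, 0 <= f x) -> 0 <= m f}
    & m (fun=> 1) = 1].

Definition is_invariant_mean (nu : {measure set (borel X) -> \bar R})
    (m : (borel X -> R) -> R) :=
  is_mean nu m /\
  {in Lfun nu +oo%E, forall f, forall g : G, m (f \o lact g) = m f}.

Definition coamenable :=
  exists nu : {measure set (borel X) -> \bar R},
    invariant_class nu /\ exists m, is_invariant_mean nu m.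

End coamenability.

(* Main.v *)
Require Import Defs.
From HB Require Import structures.
From mathcomp Require Import all_boot all_order all_algebra finmap.
From mathcomp Require Import all_classical all_reals all_analysis.
From mathcomp Require Import measurable_realfun ess_sup_inf ring lra.

Set Implicit Arguments.
Unset Strict Implicit.
Unset Printing Implicit Defensive.

Import Order.TTheory GRing.Theory Num.Theory.
Import numFieldNormedType.Exports.

Local Open Scope classical_set_scope.
Local Open Scope ring_scope.
Local Open Scope quotient_scope.

(** Let theta_n be the mean of the first n+1 convolution powers of mu. The
    invariant mean on G / K is a limit along an ultrafilter of the averages
    f |-> \int f(xK) d theta_n(x) over a subsequence. What has to be shown is that
    theta_n and its translate by g have asymptotically the same image in G / K,
    in the total variation norm. The triviality of the boundary gives this for
    the images in K \ G; the invariance of the law of K lets one pass from K \ G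
    to G / K.

    In K \ G. The frequency of visits of a trajectory to a set of cosets before
    time n changes by O(1 / n) under the shift, and its expectations for the walks
    started at g and at 1 are the masses of that set for the images of the
    translate of theta_n by g and of theta_n ([frequency_walk]). A sequence of
    almost invariant functions that were to separate the two walks could, after
    passing to convex combinations, be assumed to converge almost surely for the
    walk started at 1 ([ae_cvg_midconvex]). As invariant events are trivial, the
    limit would be a constant ([ae_cvg_cst]), and the same constant for the walk
    started at g: the probability of an invariant event is a harmonic function of
    the starting point, and since mu is equivalent to the Haar measure such a
    nonnegative function that vanishes at 1 vanishes everywhere
    ([invariant_null]). This contradiction is [almost_invariant_oscillation].

    From K \ G to G / K. For a fixed x the subgroup K has the law of x^-1 K x, and
    the coset x (x^-1 K x) is K x. So the expectation of an integral of a function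
    of K and xK is the expectation of an integral of a function of K and Kx
    ([mass_transport]). No measure on K enters. The function in question is the
    indicator of a set on which the two images in G / K differ most, and it has
    to depend measurably on K. This is why sets of cosets are encoded by finitely
    many saturations U_i K of basic open sets ([code], [defect]), which in the
    limit account for all Borel sets of G / K ([translate_le_defect]).

    The outcome is that the expected norm of the difference tends to 0 for every
    g. Along a subsequence it is summable after integration over g
    ([summable_defects]), so for almost every K the norm tends to 0 for
    mu-almost every g. The limit of the averages is then invariant under almost
    every g, hence under all g, an element of G being a product of one of them
    and the inverse of another ([lim_average_lact]). The measure class on G / K is
    represented by the image of mu, with respect to which the images of the
    theta_n are absolutely continuous ([cesaro_null]). *)

(** * Measurability in a second countable group *)

Section topological_group_measurability.
Variable G : topGroupType.

Definition countable_base (U : nat -> set G) :=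
  (forall i, open (U i)) /\
  forall x A, nbhs x A -> exists2 i, U i x & U i `<=` A.

Lemma second_countable_base :
  @second_countable G -> exists U, countable_base U.
Proof.
move=> [B /pfcard_geP[->|[f]] [Bo Bx]].
  have /= := Bx point setT filterT; case=> ? [[]].
have fB := @funS _ _ _ _ f.
exists f; split=> [i|x A /Bx[V [BV Vx] VA]]; first by apply/Bo/fB.
by have [i _ fi] := @surj _ _ _ _ f V BV; exists i; rewrite fi.
Qed.

Lemma continuousM (T : topologicalType) (f h : T -> G) :
  continuous f -> continuous h -> continuous (fun x => f x * h x)%g.
Proof.
move=> cf ch x; apply: (@continuous_comp _ _ _ (fun x => (f x, h x))
  (fun x : G * G => x.1 * x.2)%g); last exact: mulg_continuous.
by apply: cvg_pair; [exact: cf|exact: ch].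
Qed.

Lemma continuousV (T : topologicalType) (f : T -> G) :
  continuous f -> continuous (fun x => (f x)^-1)%g.
Proof.
move=> cf x; apply: (@continuous_comp _ _ _ f (fun x : G => x^-1)%g).
  exact: cf.
exact: invg_continuous.
Qed.

Lemma measurable_borel d (T : measurableType d) (X : ptopologicalType)
    (f : T -> borel X) :
  (forall O : set X, open O -> measurable (f @^-1` O)) ->
  measurable_fun setT f.
Proof.
move=> fO; apply: (@measurability _ _ _ (borel X) _ _ (@open X)) => // _ [B oB <-].
by rewrite setTI; exact: fO.
Qed.

Lemma open_borel (X : ptopologicalType) (O : set X) :
  open O -> measurable (O : set (borel X)).
Proof. exact: sub_sigma_algebra. Qed.

(** These sets generate a sub-sigma-algebra of the Borel sigma-algebra of the
    Chabauty topology. It is used instead of the latter because maps into it are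
    easily shown measurable: compact sets need not be considered. *)
Definition hits : set (set (closedSubgroup G)) :=
  [set A | exists2 V : set G, open V &
     A = [set H : closedSubgroup G | csg_set H `&` V !=set0]].
Notation subG := (g_sigma_algebraType hits).

Lemma measurable_hits d (T : measurableType d) (L : T -> subG) :
  (forall V : set G, open V ->
     measurable [set t | csg_set (L t) `&` V !=set0]) ->
  measurable_fun setT L.
Proof.
move=> LV; apply: (@measurability _ _ _ subG _ _ hits) => // _ [_ [V oV ->] <-].
by rewrite setTI; exact: LV.
Qed.

Lemma borel_hits (A : set (closedSubgroup G)) :
  measurable (A : set subG) -> measurable (A : set (borel (closedSubgroup G))).
Proof.
apply: smallest_sub; first exact: sigma_algebra_measurable.
move=> _ [V oV ->]; apply: open_borel.
have -> : [set H : closedSubgroup G | csg_set H `&` V !=set0] =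
   chabauty_subbase (true, V) by [].
exists [set chabauty_subbase (true, V)]; last by rewrite bigcup_set1.
move=> _ ->; exists [fset (true, V)]%fset.
  by move=> i; rewrite !inE => /eqP ->.
by rewrite set_fset1 bigcap_set1.
Qed.

Section base.
Variables (U : nat -> set G) (HU : countable_base U).

(** The Borel sigma-algebra of a product may be larger than the product of the
    Borel sigma-algebras; a countable base makes open sets belong to both. *)
Lemma open_rects (O : set (G * G)) : open O ->
  O = \bigcup_(p in [set p : nat * nat | U p.1 `*` U p.2 `<=` O])
        (U p.1 `*` U p.2).
Proof.
move=> oO; apply/seteqP; split=> [[x y] Oxy|z [p +]]; last by move=> /[apply].
have : nbhs (x, y) O by apply: open_nbhs_nbhs.
case=> -[A B] /= [/HU.2[i Uix UA] /HU.2[j Ujy UB]] AB.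
exists (i, j) => // -[a b] [/= Ua Ub]; apply: AB; split; [exact: UA|exact: UB].
Qed.

Lemma measurable_open_pair d (T : measurableType d) (a b : T -> borel G)
    (O : set (G * G)) : measurable_fun setT a -> measurable_fun setT b ->
  open O -> measurable [set t | O (a t, b t)].
Proof.
move=> ma mb /open_rects OE.
have -> : [set t | O (a t, b t)] =
    \bigcup_(p in [set p : nat * nat | U p.1 `*` U p.2 `<=` O])
      (a @^-1` U p.1 `&` b @^-1` U p.2).
  rewrite [in LHS]OE; apply/seteqP; split=> [t [p Hp [/= ? ?]]|t [p Hp [/= ? ?]]];
    by exists p.
rewrite bigcup_mkcond.
apply: countable_bigcupT_measurable => [|p]; first exact: countableP.
case: ifP => _ //; apply: measurableI.
  by rewrite -[_ @^-1` _]setTI; apply: ma => //; apply: open_borel; apply: HU.1.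
by rewrite -[_ @^-1` _]setTI; apply: mb => //; apply: open_borel; apply: HU.1.
Qed.

(** Conjugation of subgroups and saturation by subgroups are both defined by
    conditions of this shape. *)
Lemma measurable_hit_pair d (T : measurableType d) (a : T -> borel G)
    (L : T -> subG) (O : set (G * G)) :
  measurable_fun setT a -> measurable_fun setT L ->
  open O -> measurable [set t | exists2 k, csg_set (L t) k & O (a t, k)].
Proof.
move=> ma mL /open_rects OE.
have -> : [set t | exists2 k, csg_set (L t) k & O (a t, k)] =
    \bigcup_(p in [set p : nat * nat | U p.1 `*` U p.2 `<=` O])
      (a @^-1` U p.1 `&`
       L @^-1` [set H : closedSubgroup G | csg_set H `&` U p.2 !=set0]).
  apply/seteqP; split=> [t [k Lk]|t [p Hp [/= ? [k [Lk Uk]]]]].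
    by rewrite {1}OE => -[p Hp [/= ? ?]]; (exists p; [exact: Hp|split=> //; exists k]).
  by exists k => //; exact: Hp.
rewrite bigcup_mkcond.
apply: countable_bigcupT_measurable => [|p]; first exact: countableP.
case: ifP => _ //; apply: measurableI.
  by rewrite -[_ @^-1` _]setTI; apply: ma => //; apply: open_borel; apply: HU.1.
rewrite -[_ @^-1` _]setTI; apply: mL => //; apply: sub_sigma_algebra.
by exists (U p.2) => //; apply: HU.1.
Qed.

Lemma measurable_mulg d (T : measurableType d) (a b : T -> borel G) :
  measurable_fun setT a -> measurable_fun setT b ->
  measurable_fun setT (fun t => ((a t : G) * (b t : G))%g : borel G).
Proof.
move=> ma mb; apply: measurable_borel => O oO.
apply: (measurable_open_pair (O := [set p : G * G | O (p.1 * p.2)%g])) => //.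
by apply: open_comp oO => x _; exact: mulg_continuous.
Qed.

Lemma measurable_lmulg (g : G) :
  measurable_fun setT (fun x : borel G => (g * (x : G))%g : borel G).
Proof. exact: (@measurable_mulg _ (borel G) (fun=> g) id). Qed.

Lemma measurable_csg_conj d (T : measurableType d) (a : T -> borel G)
    (L : T -> subG) : measurable_fun setT a -> measurable_fun setT L ->
  measurable_fun setT (fun t => csg_conj (a t : G)^-1%g (L t) : subG).
Proof.
move=> ma mL; apply: measurable_hits => V oV.
pose O := [set p : G * G | V (p.1^-1 * p.2 * p.1)%g].
have -> : [set t | csg_set (csg_conj (a t : G)^-1%g (L t)) `&` V !=set0] =
    [set t | exists2 k, csg_set (L t) k & O (a t, k)].
  apply/seteqP; split=> [t [x [/= Lx Vx]]|t [k Lk Ok]].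
    exists (x ^ (a t : G)^-1)%g => //; rewrite /O /=.
    by rewrite conjgE invgK !mulgA mulVg mul1g mulgVK.
  exists (k ^ (a t : G))%g; split; first by rewrite /= /conj_set /= conjgK.
  by move: Ok; rewrite /O /= conjgE mulgA.
apply: measurable_hit_pair => //; apply: open_comp oV => x _.
have c1 : continuous (fst : G * G -> G) by move=> ?; exact: cvg_fst.
have c2 : continuous (snd : G * G -> G) by move=> ?; exact: cvg_snd.
by apply: continuousM => //; apply: continuousM => //; apply: continuousV.
Qed.

(** The sets U_i H generate the Borel sigma-algebra of G / H. The code of x tells
    which of the first m of them contain x, so it is constant on cosets xH, and
    it is measurable in H and x jointly. *)
Definition code m (H : subG) (x : G) : {ffun 'I_m -> bool} :=
  [ffun i : 'I_m => `[< exists2 k, csg_set H k & U i (x * k)%g >]].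

Lemma measurable_code d (T : measurableType d) m (a : T -> borel G)
    (L : T -> subG) (t : {ffun 'I_m -> bool}) :
  measurable_fun setT a -> measurable_fun setT L ->
  measurable [set w | code m (L w) (a w) = t].
Proof.
move=> ma mL; pose O i := [set p : G * G | U i (p.1 * p.2)%g].
pose B i := [set w | exists2 k, csg_set (L w) k & O i (a w, k)].
have mB i : measurable (B i).
  apply: measurable_hit_pair => //; apply: open_comp (HU.1 i) => x _.
  exact: mulg_continuous.
have -> : [set w | code m (L w) (a w) = t] =
    \bigcap_(i in [set: 'I_m]) (if t i then B i else ~` B i).
  apply/seteqP; split=> [w /= <- i _|w Bw /=].
    by rewrite ffunE; case: asboolP.
  apply/ffunP => i; have := Bw i Logic.I; rewrite ffunE.
  by case: (t i) => [?|?]; [exact/asboolP|exact/asboolPn].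
apply: fin_bigcap_measurable => // i _; case: (t i) => //; exact: measurableC.
Qed.

End base.
End topological_group_measurability.
Notation subG G := (g_sigma_algebraType (@hits G)).

(** * Almost sure convergence *)

Section probability_integrals.
Context d (T : measurableType d) (R : realType) (P : probability T R).

Lemma bounded_integrable (f : T -> R) (M : R) :
  measurable_fun setT f -> (forall x, `|f x| <= M) ->
  P.-integrable setT (EFin \o f).
Proof.
move=> mf fM; apply: measurable_bounded_integrable => //.
  by apply: (le_lt_trans (probability_le1 P measurableT)); rewrite ltry.
exists M; split; first exact: num_real.
by move=> x Mx y _; exact: le_trans (fM y) (ltW Mx).
Qed.

Lemma bounded_cvg (f : nat -> T -> R) (l M : R) :
  (forall n, measurable_fun setT (f n)) -> (forall n x, `|f n x| <= M) ->
  {ae P, forall x, f n x @[n --> \oo] --> l} ->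
  (\int[P]_x f n x) @[n --> \oo] --> l.
Proof.
move=> mf fM fl.
have [|||||_ _ cvg] := @dominated_convergence _ _ _ P _ measurableT
  (fun n => EFin \o f n) (cst l%:E) (cst M%:E).
- by move=> n; apply/measurable_EFinP.
- exact: measurable_cst.
- by apply: filterS fl => x h _; apply: cvg_EFin => //; exact: nearW.
- exact: finite_measure_integrable_cst.
- by apply: aeW => x n _; rewrite lee_fin.
have lE : (\int[P]_x (cst l%:E x) = l%:E)%E.
  by rewrite integral_cst//= probability_setT mule1.
by move: cvg; rewrite lE => /fine_cvg.
Qed.

Lemma geometric_summable (a : nat -> \bar R) (c : R) :
  (forall n, (0 <= a n)%E) -> (forall n, (a n <= (c / (2 ^ n.+1)%:R)%:E)%E) ->
  (\sum_(i <oo) a i < +oo)%E.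
Proof.
move=> a0 ac; apply: (@le_lt_trans _ _ (\sum_(i <oo) (c / (2 ^ i.+1)%:R)%:E)%E).
  exact: lee_nneseries.
have -> : (\sum_(i <oo) (c / (2 ^ i.+1)%:R)%:E)%E = (c / 2 ^+ 0)%:E.
  rewrite -(cvg_lim _ (@cvg_geometric_eseries_half R c 0%N))//.
  by apply: eq_eseriesr => i _; rewrite addn1.
by rewrite ltry.
Qed.

Lemma ae_summable (f : nat -> T -> \bar R) :
  (forall n, measurable_fun setT (f n)) -> (forall n x, (0 <= f n x)%E) ->
  (\sum_(i <oo) \int[P]_x f i x < +oo)%E ->
  {ae P, forall x, (\sum_(i <oo) f i x < +oo)%E}.
Proof.
move=> mf f0 fc; pose F x := (\sum_(i <oo) f i x)%E.
have F0 x : (0 <= F x)%E by apply: nneseries_ge0.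
have mF : measurable_fun setT F by exact: ge0_emeasurable_sum.
have iF : P.-integrable setT F.
  apply/integrableP; split => //.
  under eq_integral do rewrite gee0_abs//.
  by rewrite integral_nneseries.
apply: filterS (integrable_ae measurableT iF) => x /(_ Logic.I).
by rewrite ge0_fin_numE.
Qed.

Lemma cvg_summable_increments (u : nat -> R) :
  (\sum_(i <oo) `|u i.+1 - u i|%:E < +oo)%E -> cvgn u.
Proof.
move=> sfin; set S := (\sum_(i <oo) _)%E in sfin.
have S0 : (0 <= S)%E by apply: nneseries_ge0 => i _ _; rewrite lee_fin.
have cs : cvgn [normed series (telescope u)].
  apply: nondecreasing_is_cvgn.
    by apply: nondecreasing_series => i _ _ /=.
  exists (fine S) => _ [n _ <-] /=.
  rewrite -lee_fin fineK ?ge0_fin_numE// -sumEFin.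
  by apply: nneseries_lim_ge => i _ _; rewrite lee_fin.
have := normed_cvg cs; rewrite telescopeK => h.
suff -> : u = ([sequence u n - u 0%N]_n : nat -> R) + cst (u 0%N).
  by apply: is_cvgD => //; exact: is_cvg_cst.
by apply/funext => n /=; rewrite !fctE subrK.
Qed.

(** By the parallelogram law, elements of the sets whose L^2 norms are nearly
    minimal form a Cauchy sequence. This serves the purpose of the weak sequential
    compactness of the unit ball, and gives convergence almost everywhere; it
    applies to sets defined by linear inequalities. *)
Lemma ae_cvg_midconvex (C : nat -> set (T -> R)) :
  (forall n, C n !=set0) -> (forall n m, (n <= m)%N -> C m `<=` C n) ->
  (forall n f, C n f -> measurable_fun setT f /\ forall x, `|f x| <= 1) ->
  (forall n f g, C n f -> C n g -> C n (fun x => (f x + g x) / 2)) ->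
  exists2 F : nat -> T -> R, forall k, C k (F k) &
    {ae P, forall x, cvgn (F ^~ x)}.
Proof.
move=> C0 Cd C1 Cmid.
pose E (f : T -> R) := \int[P]_x (f x ^+ 2).
pose I n := inf (E @` C n).
have msq (f : T -> R) : measurable_fun setT f ->
    measurable_fun setT (fun x => f x ^+ 2) by move=> mf; exact: measurable_funX.
have isq n f : C n f -> P.-integrable setT (EFin \o (fun x => f x ^+ 2)).
  move=> /C1[mf f1]; apply: (@bounded_integrable _ 1); first exact: msq.
  by move=> x; rewrite normrX exprn_ile1.
have E0 f : 0 <= E f by apply: Rintegral_ge0 => x _; exact: sqr_ge0.
have E1 n f : C n f -> E f <= 1.
  move=> Cf; have [mf f1] := C1 _ _ Cf.
  apply: (@le_trans _ _ (\int[P]_x 1)).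
    apply: le_Rintegral => //; first exact: isq Cf.
      by apply: (@bounded_integrable _ 1) => // x; rewrite normr1.
    by move=> x _; rewrite -real_normK ?num_real// exprn_ile1.
  by rewrite Rintegral_cst//= probability_setT mulr1.
have IE n f : C n f -> I n <= E f.
  by move=> Cf; apply: ge_inf; [exists 0 => _ [g _ <-]|exists f].
have I1 n : I n <= 1.
  by have [f Cf] := C0 n; exact: le_trans (IE _ _ Cf) (E1 _ _ Cf).
(* s is the limit of the minimal squared norms I n of the sets C n. *)
pose s := sup (range I).
have Is n : I n <= s by apply: ub_le_sup; [exists 1 => _ [m _ <-]|exists n].
have Iinc n m : (n <= m)%N -> I n <= I m.
  move=> nm; apply: lb_le_inf; first by have [f Cf] := C0 m; exists (E f), f.
  by move=> _ [f Cf <-]; apply/IE/(Cd n m).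
pose e k : R := 4^-1 ^+ k.
have e0 k : 0 < e k by rewrite exprn_gt0// invr_gt0.
have /choice[N HN] : forall k, exists N, s - e k < I N.
  move=> k; have [||_ [n _ <-] ?] := @sup_adherent _ (range I) (e k); last by exists n.
    exact: e0.
  by split; [exists (I 0%N), 0%N|exists 1 => _ [m _ <-]].
(* n k is at least k and N k, and n is nondecreasing, so that the midpoint of
   F k and F k.+1 lies in C (n k). *)
pose n k := (k + \sum_(i < k.+1) N i)%N.
have nk k : (k <= n k)%N by rewrite leq_addr.
have nS k : (n k <= n k.+1)%N.
  by rewrite /n [in leqRHS]big_ord_recr/= leq_add// leq_addr.
have nN k : (N k <= n k)%N.
  by rewrite /n big_ord_recr/= addnA leq_addl.
have /choice[F HF] : forall k, exists f, C (n k) f /\ E f < I (n k) + e k.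
  move=> k; have [||_ [f Cf <-] ?] := @inf_adherent _ (E @` C (n k)) (e k).
  - exact: e0.
  - by split; [have [f Cf] := C0 (n k); exists (E f), f|exists 0 => _ [g _ <-]].
  - by exists f.
exists F => [k|]; first by apply: (Cd _ _ (nk k)); exact: (HF k).1.
have D2 k : E (fun x => F k.+1 x - F k x) <= 8 * e k.
  have Ck := (HF k).1; have Ck1 := Cd _ _ (nS k) _ (HF k.+1).1.
  have Cm := Cmid _ _ _ Ck1 Ck.
  have : E (fun x => F k.+1 x - F k x) + 4 * E (fun x => (F k.+1 x + F k x) / 2)
      = 2 * E (F k.+1) + 2 * E (F k).
    have mD : measurable_fun setT (fun x => F k.+1 x - F k x).
      by apply: measurable_funB; [exact: (C1 _ _ Ck1).1|exact: (C1 _ _ Ck).1].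
    have iD : P.-integrable setT (EFin \o (fun x => (F k.+1 x - F k x) ^+ 2)).
      apply: (@bounded_integrable _ 4); first exact: msq.
      move=> x; rewrite normrX (_ : 4 = 2 ^+ 2); last by rewrite -natrX.
      rewrite lerXn2r// ?nnegrE// (le_trans (ler_normB _ _))//.
      have := (C1 _ _ Ck1).2 x; have := (C1 _ _ Ck).2 x; lra.
    have iZ (a : R) f : P.-integrable setT (EFin \o f) ->
        P.-integrable setT (EFin \o (fun x => a * f x)).
      by move=> /(integrableZl measurableT a).
    rewrite /E -!RintegralZl//; [|exact: isq Ck|exact: isq Ck1|exact: isq Cm].
    rewrite -!RintegralD//; [|apply: iZ; exact: isq Ck1|apply: iZ; exact: isq Ck
      |apply: iZ; exact: isq Cm].
    by apply: eq_Rintegral => x _; field.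
  have := IE _ _ Cm; have := (HF k).2; have := (HF k.+1).2.
  have := Is (n k); have := Is (n k.+1); have := HN k; have := Iinc _ _ (nN k).
  have : e k.+1 = e k / 4 by rewrite /e exprSr.
  have := e0 k; lra.
have mFk k : measurable_fun setT (F k) by exact: (C1 _ _ (HF k).1).1.
have mD k : measurable_fun setT (fun x => F k.+1 x - F k x).
  exact: measurable_funB.
pose t k : R := 2^-1 ^+ k.
have t0 k : 0 < t k by rewrite exprn_gt0// invr_gt0.
have te k : e k = t k ^+ 2
  by rewrite /e /t -exprM mulnC exprM expr2 -invfM -natrM.
have F1 k x : `|F k x| <= 1 by exact: (C1 _ _ (HF k).1).2.
apply: filterS (fun x h => cvg_summable_increments h)
  (@ae_summable (fun k x => `|F k.+1 x - F k x|%:E) _ _ _).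
- by move=> k; apply/measurable_EFinP; apply: measurableT_comp.
- by move=> k x; rewrite lee_fin.
- apply: (@geometric_summable _ 18) => k.
    by apply: integral_ge0 => x _; rewrite lee_fin.
  (* |a| <= t + a^2 / t turns the L^2 bound into an L^1 bound. *)
  have iA : P.-integrable setT (EFin \o (fun x => `|F k.+1 x - F k x|)).
    apply: (@bounded_integrable _ 2); first exact: measurableT_comp.
    move=> x; rewrite normr_id (le_trans (ler_normB _ _))//.
    have := F1 k x; have := F1 k.+1 x; lra.
  have iD : P.-integrable setT
      (EFin \o (fun x => (t k)^-1 * (F k.+1 x - F k x) ^+ 2)).
    apply: (@bounded_integrable _ ((t k)^-1 * 4)).
      by apply: measurable_funM => //; exact: msq.
    have tV : 0 <= (t k)^-1 by rewrite invr_ge0 ltW.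
    move=> x; rewrite normrM normrX (ger0_norm tV); apply: ler_wpM2l => //.
    rewrite (_ : 4 = 2 ^+ 2); last by rewrite -natrX.
    rewrite lerXn2r// ?nnegrE// (le_trans (ler_normB _ _))//.
    have := F1 k x; have := F1 k.+1 x; lra.
  have iT : P.-integrable setT (EFin \o (fun=> t k)).
    by apply: (@bounded_integrable _ `|t k|).
  rewrite -[leLHS]fineK; last by have := integrable_fin_num measurableT iA.
  rewrite lee_fin -/(Rintegral P setT (fun x => `|F k.+1 x - F k x|)).
  apply: (@le_trans _ _ (\int[P]_x (t k + (t k)^-1 * (F k.+1 x - F k x) ^+ 2))).
    apply: le_Rintegral => //; first exact: (integrableD measurableT iT iD).
    move=> x _; have [le|lt] := leP `|F k.+1 x - F k x| (t k).
      by rewrite (le_trans le)// lerDl mulr_ge0// ?sqr_ge0// invr_ge0 ltW.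
    rewrite -[_ ^+ 2]real_normK ?num_real//.
    have a0 := lt_trans (t0 k) lt.
    rewrite -[leLHS]add0r; apply: lerD; first exact: ltW.
    rewrite -[leLHS](mulKf (lt0r_neq0 (t0 k))) ler_pM2l ?invr_gt0// expr2.
    by rewrite ler_pM2r// ltW.
  rewrite RintegralD// Rintegral_cst//= probability_setT mulr1 RintegralZl//; last first.
    apply: (@bounded_integrable _ 4); first exact: msq.
    move=> x; rewrite normrX (_ : 4 = 2 ^+ 2); last by rewrite -natrX.
    rewrite lerXn2r// ?nnegrE// (le_trans (ler_normB _ _))//.
    have := F1 k x; have := F1 k.+1 x; lra.
  have -> : 18 / (2 ^ k.+1)%:R = t k + (t k)^-1 * (8 * e k).
    rewrite te (_ : (t k)^-1 * (8 * t k ^+ 2) = 8 * t k).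
      by rewrite natrX exprS /t exprVn; field; rewrite expf_neq0.
    by field; rewrite lt0r_neq0.
  by rewrite lerD2l ler_pM2l ?invr_gt0//; exact: D2.
Qed.

End probability_integrals.

(** * The random walk and the shift *)

Section random_walk_markov.
Context (R : realType) (G : topGroupType) (U : nat -> set G).
Hypothesis HU : countable_base U.
Context (mu : probability (borel G) R) (dW : measure_display)
  (W : measurableType dW) (PW : probability W R)
  (h : nat -> {mfun W >-> borel G}).
Hypothesis h_iid : is_iid PW mu h.
Hypothesis mu_null : forall (g : G) (A : set (borel G)), measurable A ->
  mu A = 0%E -> mu [set x | A (g * (x : G))%g] = 0%E.

Definition box n (B : nat -> set G) : set (nat -> G) :=
  [set w | forall i, (i < n)%N -> B i (w i)].

Definition boxes : set (set (nat -> G)) :=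
  [set A | exists n (B : nat -> set (borel G)),
     (forall i, measurable (B i)) /\ A = box n B].

Notation incr := (g_sigma_algebraType boxes).

Lemma measurable_incr d (T : measurableType d) (o : T -> incr) :
  (forall i, measurable_fun setT (fun t => o t i : borel G)) ->
  measurable_fun setT o.
Proof.
move=> mo; apply: (@measurability _ _ _ incr _ _ boxes) => // _ [_ [n [B [mB ->]]] <-].
rewrite setTI (_ : _ @^-1` _ = \bigcap_(i in [set i | (i < n)%N])
    ((fun t => o t i : borel G) @^-1` B i)) //.
by apply: bigcap_measurableType => i _; rewrite -[_ @^-1` _]setTI; exact: mo.
Qed.

Lemma measurable_coord i : measurable_fun setT (fun w : incr => w i : borel G).
Proof.
move=> _ A mA; rewrite setTI; apply: sub_sigma_algebra.
exists i.+1, (fun j => if j == i then A else setT); split.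
  by move=> j; case: ifP.
apply/seteqP; split=> [w /= Aw j _|w /(_ i (ltnSn i))]; last by rewrite eqxx.
by case: eqP => // ->.
Qed.

Definition increments (w : W) : incr := fun n => h n w.
Let increments_measurable : measurable_fun setT increments.
Proof. by apply: measurable_incr => i; exact: measurable_funPT. Qed.
HB.instance Definition _ :=
  isMeasurableFun.Build _ _ _ _ increments increments_measurable.

Definition incr_law : probability incr R := distribution PW increments.
Notation M := incr_law.

Definition incr_cons (p : borel G * incr) : incr :=
  fun n => if n is m.+1 then p.2 m else p.1.
Let incr_cons_measurable : measurable_fun setT incr_cons.
Proof.
apply: measurable_incr => -[|i]; first exact: measurable_fst.
exact: (measurableT_comp (measurable_coord i) measurable_snd).
Qed.
HB.instance Definition _ :=
  isMeasurableFun.Build _ _ _ _ incr_cons incr_cons_measurable.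

Lemma measurable_box n (B : nat -> set (borel G)) :
  (forall i, measurable (B i)) -> measurable (box n B : set incr).
Proof. by move=> mB; apply: sub_sigma_algebra; exists n, B. Qed.

Lemma incr_law_box n (B : nat -> set (borel G)) :
  (forall i, measurable (B i)) -> M (box n B) = (\prod_(i < n) mu (B i))%E.
Proof.
move=> mB; rewrite /incr_law /distribution /pushforward /=.
pose J := [fset i in iota 0 n]%fset.
have JP i : (i \in J) = (i < n)%N by rewrite in_fset /= mem_iota.
have incrE : increments @^-1` box n B =
    \bigcap_(i in [set` J]) (h i @^-1` B i).
  apply/seteqP; split=> w /= Hw i; first by rewrite /= JP => /Hw.
  by move=> ni; apply: Hw; rewrite /= JP.
transitivity (PW (\bigcap_(i in [set` J]) (h i @^-1` B i))).
  by congr (PW _); exact: incrE.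
rewrite h_iid.1; last by move=> i _; exact: mB.
transitivity (\prod_(i <- iota 0 n) PW (h i @^-1` B i))%E.
  apply: perm_big; apply: uniq_perm; [exact: fset_uniq|exact: iota_uniq|].
  by move=> i; rewrite JP mem_iota.
rewrite -[n in iota 0 n]subn0 -/(index_iota 0 n) big_mkord.
by apply: eq_bigr => i _; rewrite -(h_iid.2 i).
Qed.

(** The Markov property: putting an independent mu-distributed increment in front
    of the increments does not change their law. *)
Lemma incr_law_cons (E : set incr) : measurable E ->
  M E = (mu \x M)%E (incr_cons @^-1` E).
Proof.
have EG : @measurable _ incr = <<s boxes >> by [].
rewrite EG; apply: (@g_sigma_algebra_measure_unique _ _ incr boxes _ (fun=> setT)
   _ _ M (distribution (mu \x M)%E incr_cons)).
- by move=> _ [n [B [mB ->]]]; exact: measurable_box.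
- move=> _; exists 0%N, (fun=> setT); split => //.
  by apply/seteqP; split.
- by rewrite bigcup_const.
- move=> _ _ [n [B [mB ->]]] [m [C [mC ->]]].
  exists (maxn n m), (fun i => (if (i < n)%N then B i else setT) `&`
      (if (i < m)%N then C i else setT)); split.
    by move=> i; apply: measurableI; case: ifP.
  apply/seteqP; split=> w /=.
    by move=> [Bw Cw] i _; split; case: ifP => // ?; [exact: Bw|exact: Cw].
  move=> BCw; split=> i ni.
    by have := BCw i; rewrite leq_max ni => /(_ isT)[].
  by have := BCw i; rewrite leq_max ni orbT => /(_ isT)[].
- move=> _ [[|n] [B [mB ->]]].
    have -> : box 0 B = setT by apply/seteqP; split.
    exact: (etrans (probability_setT M)
      (esym (probability_setT (distribution (mu \x M)%E incr_cons)))).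
  rewrite [LHS](incr_law_box n.+1 mB) /distribution /pushforward.
  have consE : incr_cons @^-1` box n.+1 B = B 0%N `*` box n (fun i => B i.+1).
    apply/seteqP; split=> [[x w] Bxw|[x w] [/= Bx Bw] [|i] ni] //=.
    - split; first exact: (Bxw 0%N isT).
      by move=> i ni; exact: (Bxw i.+1 ni).
    - exact: Bw.
  transitivity ((mu \x M)%E (B 0%N `*` box n (fun i => B i.+1))).
    rewrite product_measure1E//; last exact: measurable_box.
    by rewrite [X in (_ * X)%E]incr_law_box// big_ord_recl.
  by congr ((mu \x M)%E _); exact/esym/consE.
- by move=> _; rewrite (le_lt_trans (probability_le1 M measurableT))// ltry.
Qed.

Section walk.
Variable H : closedSubgroup G.
Notation X := (rcoset_space H).
Notation traj := (g_sigma_algebraType (@cylinders G H)).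

Definition walk (g : G) (w : nat -> G) : traj :=
  fun n => \pi_X (g * \prod_(i < n.+1) w i)%g.

Lemma coset_walkE w : coset_walk H h w = walk 1%g (increments w).
Proof. by apply/funext => n; rewrite /coset_walk /walk mul1g. Qed.

Lemma shift_walk_cons g x (w : incr) :
  Defs.shift (walk g (incr_cons (x, w))) = walk (g * x)%g w.
Proof.
apply/funext => n; rewrite /Defs.shift /walk big_ord_recl /= mulgA.
by congr (\pi_X (_ * _)%g); apply: eq_bigr => i _.
Qed.

Lemma measurable_pi : measurable_fun setT ((\pi_X : G -> X) : borel G -> borel X).
Proof.
apply: measurable_borel => O oO; apply: open_borel.
exact: (continuousP _).1 (@pi_continuous _ _) _ oO.
Qed.

Lemma measurable_traj d (T : measurableType d) (y : T -> traj) :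
  (forall n, measurable_fun setT (fun t => y t n : borel X)) ->
  measurable_fun setT y.
Proof.
move=> my; apply: (@measurability _ _ _ traj _ _ (@cylinders G H)) => //.
move=> _ [_ [n [B [mB ->]]] <-].
by rewrite setTI -[_ @^-1` _]setTI; exact: (my n).
Qed.

Lemma measurable_traj_coord n :
  measurable_fun setT (fun y : traj => y n : borel X).
Proof.
by move=> _ A mA; rewrite setTI; apply: sub_sigma_algebra; exists n, A.
Qed.

Lemma measurable_partial_prod d (T : measurableType d) (a : T -> borel G)
    (o : T -> incr) n : measurable_fun setT a -> measurable_fun setT o ->
  measurable_fun setT (fun t => ((a t : G) * \prod_(i < n) o t i)%g : borel G).
Proof.
move=> ma mo; elim: n => [|n IH].
  by under eq_fun do rewrite big_ord0 mulg1.
under eq_fun do rewrite big_ord_recr /= mulgA.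
apply: (measurable_mulg HU IH).
exact: (measurableT_comp (measurable_coord n) mo).
Qed.

Lemma measurable_walk d (T : measurableType d) (a : T -> borel G)
    (o : T -> incr) : measurable_fun setT a -> measurable_fun setT o ->
  measurable_fun setT (fun t => walk (a t) (o t)).
Proof.
move=> ma mo; apply: measurable_traj => n; rewrite /walk.
apply: (measurableT_comp measurable_pi).
exact: measurable_partial_prod.
Qed.

Lemma measurable_walk_preimage g (B : set traj) : measurable B ->
  measurable [set w : incr | B (walk g w)].
Proof.
move=> mB; rewrite -[[set _ | _]]setTI.
exact: (@measurable_walk _ incr (fun=> g) id _ _ measurableT _ mB).
Qed.

(** An invariant event that is null for the walk started at the base point is
    null for the walk started anywhere: its probability is a nonnegative
    mu-harmonic function of the starting point, hence vanishes mu-almost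
    everywhere, hence everywhere as mu is quasi-invariant. *)
Lemma invariant_null (B : set traj) : measurable B -> (@Defs.shift G H) @^-1` B = B ->
  M [set w | B (walk 1%g w)] = 0%E -> forall g, M [set w | B (walk g w)] = 0%E.
Proof.
move=> mB sB B1.
pose p (g : borel G) := M [set w | B (walk g w)].
pose A := [set q : borel G * incr | B (walk q.1 q.2)].
have mA : measurable A.
  rewrite -[A]setTI.
  exact: (@measurable_walk _ (borel G * incr)%type fst snd measurable_fst
    measurable_snd measurableT _ mB).
have pE : p = M \o xsection A.
  apply/funext => g; rewrite /p /=; congr (M _).
  by apply/seteqP; split=> w; rewrite /xsection /= inE.
have mp : measurable_fun setT p by rewrite pE; exact: measurable_fun_xsection.
have harm g : p g = (\int[mu]_x p ((g : G) * (x : G))%g)%E.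
  rewrite [LHS]incr_law_cons; last exact: measurable_walk_preimage.
  rewrite /product_measure1; apply: eq_integral => x _; congr (M _).
  have key w : B (walk g (incr_cons (x, w))) = B (walk (g * (x : G))%g w).
    by rewrite -shift_walk_cons -[in LHS]sB.
  by apply/seteqP; split=> w; rewrite /xsection /= inE /= key.
have p0 : ae_eq mu setT p (cst 0%E).
  apply/(ae_eq_integral_abs _ measurableT mp).
  transitivity (p 1%g); last by [].
  rewrite [RHS]harm; apply: eq_integral => x _; rewrite mul1g gee0_abs//.
have mN : measurable [set x | p x != 0%E].
  by rewrite -[[set _ | _]]setTI; exact: emeasurable_neq.
have N0 : mu [set x | p x != 0%E] = 0%E.
  case: p0 => N [mN' N0 sub]; apply: (subset_measure0 mN mN' _ N0) => x /= px.
  by apply: sub => /= /(_ Logic.I) px0; rewrite px0 eqxx in px.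
move=> g; rewrite -/(p g) harm.
transitivity (\int[mu]_x (cst 0%E x : \bar R))%E; last by rewrite integral0.
apply: ae_eq_integral => //.
- apply: (measurableT_comp mp).
  exact: (measurable_lmulg HU).
- exists [set x | p ((g : G) * (x : G))%g != 0%E]; split.
  + rewrite -[[set _ | _]]setTI.
    exact: (measurable_lmulg HU g measurableT mN).
  + exact: mu_null mN N0.
  + by move=> x /= /not_implyP[_ /eqP].
Qed.

End walk.
End random_walk_markov.

Notation incr G := (g_sigma_algebraType (@boxes G)).
Notation traj H := (g_sigma_algebraType (@cylinders _ H)).

(** * Trivial boundary and oscillation of invariant functions *)

Section limit_sets.
Context d (T : measurableType d) (R : realType).

Lemma ex_invS_lt (e : R) : 0 < e -> exists m, m.+1%:R^-1 < e.
Proof. by move=> /ltr_add_invr[m]; rewrite add0r; exists m. Qed.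

(** The points where the upper limit of u is at most 0, written with countable
    operations only. *)
Definition limsup_le0 (u : nat -> T -> R) : set T :=
  \bigcap_m \bigcup_N \bigcap_(k in [set k | (N <= k)%N])
    [set x | u k x <= m.+1%:R^-1].

Lemma limsup_le0P (u : nat -> T -> R) x :
  limsup_le0 u x <-> forall e, 0 < e -> \forall k \near \oo, u k x <= e.
Proof.
split=> [ux e e0|ux m _].
  have [m me] := ex_invS_lt e0.
  have [N _ HN] := ux m Logic.I; exists N => // k Nk.
  exact: le_trans (HN k Nk) (ltW me).
have /ux[N _ HN] : (0 : R) < m.+1%:R^-1 by rewrite invr_gt0.
by exists N => // k; exact: HN.
Qed.

Lemma measurable_limsup_le0 (u : nat -> T -> R) :
  (forall k, measurable_fun setT (u k)) -> measurable (limsup_le0 u).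
Proof.
move=> mu; apply: bigcap_measurableType => m _.
apply: bigcup_measurable => N _; apply: bigcap_measurableType => k _.
rewrite -[X in measurable X]setTI.
exact: (mu k measurableT _ (measurable_itv `]-oo, _])).
Qed.

Lemma limsup_le0_shift (u : nat -> T -> R) x y :
  (forall k, u k y <= u k x + 2 / k.+1%:R) ->
  limsup_le0 u x -> limsup_le0 u y.
Proof.
move=> uyx /limsup_le0P ux; apply/limsup_le0P => e e0.
have e2 : 0 < e / 2 by rewrite divr_gt0.
have e4 : 0 < e / 4 by rewrite divr_gt0.
near=> k; apply: le_trans (uyx k) _.
rewrite [leRHS](splitr e) lerD//; first by near: k; exact: ux.
suff : k.+1%:R^-1 < e / 4 by move: (k.+1%:R^-1) => t; lra.
by near: k; exact: (near_infty_natSinv_lt (PosNum e4)).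
Unshelve. all: by end_near. Qed.

Lemma cvg_limsup_le0 (u : nat -> T -> R) (c : R) x :
  limsup_le0 (fun k x => `|u k x - c|) x <-> u k x @[k --> \oo] --> c.
Proof.
split=> [/limsup_le0P ux|/cvgrPdist_le ux].
  by apply/cvgrPdist_le => e /ux; apply: filterS => k; rewrite distrC.
by apply/limsup_le0P => e /ux; apply: filterS => k; rewrite distrC.
Qed.

Lemma lim_limsup_le0 (u : nat -> T -> R) (c l : R) x :
  u k x @[k --> \oo] --> l -> limsup_le0 (fun k x => u k x - c) x <-> l <= c.
Proof.
move=> ul; split=> [/limsup_le0P ux|lc].
  apply/ler_addgt0Pr => e e0; rewrite -(cvg_lim _ ul)//.
  apply: limr_le; first by apply/cvg_ex; exists l.
  by apply: filterS (ux _ e0) => k; rewrite lerBlDl.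
apply/limsup_le0P => e e0; move/cvgrPdist_le : ul => /(_ _ e0).
by apply: filterS => k; rewrite ler_distlC => /andP[_ h]; lra.
Qed.

End limit_sets.

Section trivial_boundary_ergodic.
Context (R : realType) (G : topGroupType) (U : nat -> set G).
Hypothesis HU : countable_base U.
Context (mu : probability (borel G) R) (dW : measure_display)
  (W : measurableType dW) (PW : probability W R)
  (h : nat -> {mfun W >-> borel G}).
Hypothesis h_iid : is_iid PW mu h.
Hypothesis mu_null : forall (g : G) (A : set (borel G)), measurable A ->
  mu A = 0%E -> mu [set x | A (g * (x : G))%g] = 0%E.
Variable H : closedSubgroup G.
Hypothesis H_trivial : trivial_boundary H PW h.
Notation M := (incr_law PW h).

Lemma invariant01 (E : set (traj H)) : measurable E ->
  @Defs.shift G H @^-1` E = E ->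
  M [set w | E (walk H 1%g w)] = 0%E \/ M [set w | E (walk H 1%g w)] = 1%E.
Proof.
move=> mE sE.
have := H_trivial mE sE.
have -> : pushforward PW (coset_walk H h) E = M [set w | E (walk H 1%g w)].
  rewrite /incr_law /distribution /pushforward; congr (PW _).
  by apply/seteqP; split=> w; rewrite /preimage /= coset_walkE.
by [].
Qed.

(** Averages over n.+1 consecutive coordinates satisfy this bound, as the shift
    changes only the two extreme terms of the sum. *)
Definition almost_invariant n : set (traj H -> R) :=
  [set f : traj H -> R | [/\ measurable_fun setT f, forall x, `|f x| <= 1 &
     forall x, `|f (Defs.shift x) - f x| <= 2 / n.+1%:R]].

Lemma almost_invariant_le n m : (n <= m)%N ->
  almost_invariant m `<=` almost_invariant n.
Proof.
move=> nm f [mf f1 fs]; split=> // x.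
apply: le_trans (fs x) _; rewrite ler_pM2l// lef_pV2 ?posrE ?ltr0Sn//.
by rewrite ler_nat ltnS.
Qed.

Lemma almost_invariantN n f :
  almost_invariant n f -> almost_invariant n (fun x => - f x).
Proof.
move=> [mf f1 fs]; split=> [|x|x]; first exact: measurableT_comp.
  by rewrite normrN.
by rewrite -opprD normrN.
Qed.

(** As the functions become shift-invariant, the sets where their upper limit is
    at most q are exactly invariant, so they have probability 0 or 1 for the walk
    from the base point, and the limit is a constant c. The set where the
    functions do not tend to c is exactly invariant too, hence null for the walk
    from any point by [invariant_null]. *)
Lemma ae_cvg_cst (F : nat -> traj H -> R) :
  (forall k, almost_invariant k (F k)) ->
  {ae M, forall w, cvgn (fun k => F k (walk H 1%g w))} ->
  exists c : R, forall g, {ae M, forall w, F k (walk H g w) @[k --> \oo] --> c}.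
Proof.
move=> HF ac.
have mF k : measurable_fun setT (F k) by case: (HF k).
have F1 k x : `|F k x| <= 1 by case: (HF k).
have Fs k x : `|F k (Defs.shift x) - F k x| <= 2 / k.+1%:R by case: (HF k).
pose E (q : R) := limsup_le0 (fun k x => F k x - q).
have mE q : measurable (E q).
  by apply: measurable_limsup_le0 => k; exact: measurable_funB.
have sE q : @Defs.shift G H @^-1` E q = E q.
  apply/seteqP; split=> x; apply: limsup_le0_shift => k.
    by move: (Fs k x); rewrite ler_distl; move: (2 / _) => t /= /andP[? ?]; lra.
  by move: (Fs k x); rewrite ler_distl; move: (2 / _) => t /= /andP[? ?]; lra.
pose p q := M [set w | E q (walk H 1%g w)].
pose A := [set q | p q = 1%E].
have A1 : A 1.
  rewrite /A /= /p (_ : [set w | _] = setT); first exact: (probability_setT M).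
  apply/seteqP; split=> // w _ /=; apply/limsup_le0P => e e0; apply: nearW => k.
  by have := F1 k (walk H 1%g w); rewrite ler_norml => /andP[? ?]; lra.
have AN q : A q -> -2 <= q.
  move=> Aq; rewrite leNgt; apply/negP => q2.
  have : p q = 0%E.
    rewrite /p (_ : [set w | _] = set0) ?measure0//.
    apply/seteqP; split=> // w /= /limsup_le0P /(_ 1 ltr01)[N _ /(_ N (leqnn N))].
    by have := F1 N (walk H 1%g w); rewrite ler_norml => /andP[? ?]; lra.
  by rewrite Aq => /eqP; rewrite onee_eq0.
pose c := inf A.
have hA : has_inf A by split; [exists 1|exists (-2)].
have cP m : p (c + m.+1%:R^-1) = 1%E.
  have i0 : (0 : R) < m.+1%:R^-1 by rewrite invr_gt0.
  have [q Aq qc] := inf_adherent i0 hA.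
  apply/eqP; rewrite eq_le probability_le1 /=; last exact: (measurable_walk_preimage HU).
  rewrite -[X in (X <= _)%E]Aq; apply: le_measure;
    rewrite ?inE; [exact: (measurable_walk_preimage HU)..|].
  move=> w /= /limsup_le0P Eq; apply/limsup_le0P => e /Eq; apply: filterS => k.
  by move: qc => /=; rewrite -/c; move: (m.+1%:R^-1) => t; lra.
have cN m : p (c - m.+1%:R^-1) = 0%E.
  have [//|p1] := invariant01 (mE (c - m.+1%:R^-1)) (sE _).
  have := ge_inf hA.2 (p1 : A _); rewrite -/c lerBrDr gerDl.
  by rewrite leNgt invr_gt0 ltr0Sn.
have aeP : {ae M, forall w, forall m, E (c + m.+1%:R^-1) (walk H 1%g w)}.
  apply/ae_foralln => m; exists (~` [set w | E (c + m.+1%:R^-1) (walk H 1%g w)]).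
  have mEm := measurable_walk_preimage HU 1%g (mE (c + m.+1%:R^-1)).
  split=> //; first exact: measurableC.
  by rewrite [LHS](probability_setC M mEm) [X in (_ - X)%E]cP subee.
have aeN : {ae M, forall w, forall m, ~ E (c - m.+1%:R^-1) (walk H 1%g w)}.
  apply/ae_foralln => m; exists [set w | E (c - m.+1%:R^-1) (walk H 1%g w)].
  split; [exact: (measurable_walk_preimage HU)|exact: cN|].
  by move=> w /= /contrapT.
pose B := ~` limsup_le0 (fun k x => `|F k x - c|).
have mB : measurable B.
  apply/measurableC/measurable_limsup_le0 => k; apply: measurableT_comp => //.
  exact: measurable_funB.
have sB : @Defs.shift G H @^-1` B = B.
  rewrite /B -preimage_setC; congr (~` _).
  apply/seteqP; split=> x; apply: limsup_le0_shift => k.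
    move: (Fs k x); rewrite distrC; move: (2 / _) => t /=.
    by have := ler_distD (F k (Defs.shift x)) (F k x) c; lra.
  move: (Fs k x); move: (2 / _) => t /=.
  by have := ler_distD (F k x) (F k (Defs.shift x)) c; lra.
exists c => g; exists [set w | B (walk H g w)]; split.
- exact: (measurable_walk_preimage HU).
- apply: (invariant_null HU h_iid mu_null mB sB) => {g}.
  apply: measure_negligible; first exact: (measurable_walk_preimage HU).
  have : {ae M, forall w, ~ B (walk H 1%g w)}.
    have FF : Filter (nbhs (almost_everywhere M)).
      exact: ae_filter_ringOfSetsType.
    apply: filterS3 ac aeP aeN => w /cvg_ex[l Fl] wP wN; apply; apply/cvg_limsup_le0.
    suff -> : c = l by [].
    apply/eqP; rewrite eq_le; apply/andP; split; apply/ler_addgt0Pr => e e0;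
      have [m me] := ex_invS_lt e0.
      rewrite leNgt; apply/negP => lc; apply: (wN m).
      apply/(lim_limsup_le0 _ Fl).
      by rewrite lerBrDr (le_trans _ (ltW lc))// lerD2l ltW.
    have /(lim_limsup_le0 _ Fl) lc := wP m.
    by rewrite (le_trans lc)// lerD2l ltW.
  by apply: negligibleS => w Bw nBw; exact: nBw.
- by move=> w /= nc Bw; apply: nc; exact/cvg_limsup_le0.
Qed.

(** The norm form of the triviality of the boundary: n does not depend on f. If
    there were counterexamples f for every n, they would form convex sets, from
    which [ae_cvg_midconvex] extracts an almost surely convergent sequence; by
    [ae_cvg_cst] and dominated convergence both integrals then have the same
    limit. *)
Lemma almost_invariant_oscillation (g : G) (c : R) : 0 < c ->
  exists n, forall f, almost_invariant n f ->
    \int[M]_w f (walk H g w) - \int[M]_w f (walk H 1%g w) < c.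
Proof.
move=> c0; apply: contrapT => /forallNP noN.
pose C n : set (traj H -> R) := [set f | almost_invariant n f /\
  c <= \int[M]_w f (walk H g w) - \int[M]_w f (walk H 1%g w)].
have mw x : measurable_fun setT (fun w : incr G => walk H x w).
  exact: (@measurable_walk _ _ HU H _ (incr G) (fun=> x) id).
have mfw x (f : traj H -> R) : measurable_fun setT f ->
    measurable_fun setT (fun w : incr G => f (walk H x w)).
  by move=> mf; exact: (measurableT_comp mf (mw x)).
have C0 n : C n !=set0.
  have /existsNP[f /not_implyP[fn fc]] := noN n.
  by exists f; split=> //; rewrite leNgt; exact/negP.
have Cd n m : (n <= m)%N -> C m `<=` C n.
  by move=> nm f [fm fc]; split=> //; exact: almost_invariant_le fm.
have Cmid n f k : C n f -> C n k -> C n (fun x => (f x + k x) / 2).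
  move=> [[mf f1 fs] fc] [[mk k1 ks] kc]; split; first split.
  - by apply: measurable_funM => //; exact: measurable_funD.
  - by move=> x; have := f1 x; have := k1 x; rewrite !ler_norml; lra.
  - move=> x; have := fs x; have := ks x; move: (2 / _) => t.
    by rewrite !ler_norml; lra.
  have iw x (u : traj H -> R) : measurable_fun setT u ->
      (forall x, `|u x| <= 1) ->
      M.-integrable setT (EFin \o (fun w => u (walk H x w))).
    by move=> mu1 u1; apply: (@bounded_integrable _ _ _ _ _ 1) => //; exact: mfw.
  have mid x : \int[M]_w ((f (walk H x w) + k (walk H x w)) / 2) =
      (\int[M]_w f (walk H x w) + \int[M]_w k (walk H x w)) / 2.
    rewrite RintegralZr//; last first.
      apply: (@bounded_integrable _ _ _ _ _ 2).
        by apply: measurable_funD; exact: mfw.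
      by move=> w; have := f1 (walk H x w); have := k1 (walk H x w);
        rewrite !ler_norml; lra.
    by rewrite RintegralD//; exact: iw.
  by rewrite !mid; lra.
have C1 n f : C n f -> measurable_fun setT f /\ forall x, `|f x| <= 1.
  by case=> -[].
pose base (w : incr G) := walk H 1%g w.
pose mbase := isMeasurableFun.Build _ _ _ _ base (mw 1%g).
pose baseF : {mfun incr G >-> traj H} := HB.pack base mbase.
have [F FC acF] := ae_cvg_midconvex (distribution M baseF) C0 Cd C1 Cmid.
have ac : {ae M, forall w, cvgn (fun k => F k (walk H 1%g w))}.
  case: acF => N [mN N0 sub]; exists (base @^-1` N); split.
  - by rewrite -[_ @^-1` _]setTI; exact: (mw 1%g measurableT _ mN).
  - exact: N0.
  - by move=> w /= nc; exact: sub.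
have [l Fl] := ae_cvg_cst (fun k => (FC k).1) ac.
have lim x : (\int[M]_w F k (walk H x w)) @[k --> \oo] --> l.
  apply: (@bounded_cvg _ _ _ M (fun k w => F k (walk H x w)) l 1) => [k|k w|].
  - by apply: mfw; exact: (C1 _ _ (FC k)).1.
  - exact: (C1 _ _ (FC k)).2.
  - exact: Fl.
have : (\int[M]_w F k (walk H g w) - \int[M]_w F k (walk H 1%g w))
    @[k --> \oo] --> l - l by apply: cvgB; exact: lim.
move=> dl; suff : c <= l - l by rewrite subrr leNgt c0.
by apply: (cvgr_to_ge dl); apply: nearW => k; exact: (FC k).2.
Qed.

End trivial_boundary_ergodic.

(** * Averages of the convolution powers *)

Section probability_of_sets.
Context (R : realType).

Lemma fine_probability_itv d (T : measurableType d) (P : probability T R)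
  (A : set T) : measurable A -> 0 <= fine (P A) <= 1.
Proof.
move=> mA; rewrite fine_ge0//= -[leRHS]/(fine 1%E) fine_le ?fin_num_measure//.
exact: probability_le1.
Qed.

Lemma fineK_probability d (T : measurableType d) (P : probability T R)
  (A : set T) : measurable A -> (fine (P A))%:E = P A.
Proof. by move=> mA; rewrite fineK// fin_num_measure. Qed.

Lemma fine_probability_setU d (T : measurableType d) (P : probability T R)
  (A B : set T) : measurable A -> measurable B -> A `&` B = set0 ->
  fine (P (A `|` B)) = fine (P A) + fine (P B).
Proof.
by move=> mA mB AB; rewrite measureU// fineD ?fin_num_measure.
Qed.

Lemma fine_probability_fibers d (T : measurableType d) (P : probability T R)
    (I : finType) (c : T -> I) (S : {set I}) :
  (forall t, measurable [set x | c x = t]) ->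
  measurable [set x | c x \in S] /\
  fine (P [set x | c x \in S]) = \sum_(t in S) fine (P [set x | c x = t]).
Proof.
move=> mc.
have aux (s : seq I) : uniq s -> measurable [set x | c x \in s] /\
    fine (P [set x | c x \in s]) = \sum_(t <- s) fine (P [set x | c x = t]).
  elim: s => [_|t s IH /= /andP[ts us]].
    have E : [set x | c x \in [::]] = set0 by apply/seteqP; split.
    by rewrite big_nil E measure0.
  have [ms Ps] := IH us.
  have E : [set x | c x \in t :: s] = [set x | c x = t] `|` [set x | c x \in s].
    apply/seteqP; split=> x /=; rewrite inE.
      by move=> /orP[/eqP|]; [left|right].
    by move=> [->|->]; rewrite ?eqxx ?orbT.
  rewrite big_cons E -Ps; split; first exact: measurableU.
  rewrite fine_probability_setU//.
  by apply/seteqP; split=> x //= [-> xs]; rewrite xs in ts.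
have [mS PS] := aux (enum S) (enum_uniq _).
have E : [set x | c x \in S] = [set x | c x \in enum S].
  by apply/seteqP; split=> x /=; rewrite mem_enum.
rewrite E big_enum_cond /= in PS *; rewrite PS; split=> //.
by apply: eq_bigl => t; rewrite andbT.
Qed.

Lemma Rintegral_sum_indic d (T : measurableType d) (P : probability T R)
    (A : nat -> set T) n : (forall k, measurable (A k)) ->
  \int[P]_x (\sum_(k < n) \1_(A k) x) = \sum_(k < n) fine (P (A k)).
Proof.
move=> mA; elim: n => [|n IH].
  by under eq_Rintegral do rewrite big_ord0; rewrite Rintegral_cst// mul0r big_ord0.
under eq_Rintegral do rewrite big_ord_recr/=.
have i1 k : P.-integrable setT (EFin \o \1_(A k)).
  apply: (@bounded_integrable _ _ _ _ _ 1) => // x.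
  by rewrite indicE; case: (_ \in _); rewrite ?normr1 ?normr0.
rewrite RintegralD//; last first.
  apply: (@bounded_integrable _ _ _ _ _ n%:R) => [|x].
    by apply: measurable_sum => k; exact: measurable_indic.
  rewrite ger0_norm ?sumr_ge0//.
  rewrite -[n in n%:R]card_ord -sum1_card natr_sum; apply: ler_sum => k _.
  by rewrite indicE; case: (_ \in _).
by rewrite IH big_ord_recr/= /Rintegral integral_indic// setIT.
Qed.

Lemma tonelli_set d1 d2 (T1 : measurableType d1) (T2 : measurableType d2)
    (m1 : probability T1 R) (m2 : probability T2 R) (B : set (T1 * T2)) :
  measurable B ->
  (\int[m1]_x m2 [set y | B (x, y)] = \int[m2]_y m1 [set x | B (x, y)])%E.
Proof.
move=> mB; have := indic_fubini_tonelli m1 m2 mB.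
rewrite (indic_fubini_tonelli_FE m2 mB) (indic_fubini_tonelli_GE m1 mB).
move=> h; transitivity (\int[m1]_x (m2 \o xsection B) x)%E.
  apply: eq_integral => x _ /=; congr (m2 _).
  by apply/seteqP; split=> y; rewrite /xsection /= inE.
rewrite h; apply: eq_integral => y _ /=; congr (m1 _).
by apply/seteqP; split=> x; rewrite /ysection /= inE.
Qed.

Lemma measurable_section d1 d2 (T1 : measurableType d1) (T2 : measurableType d2)
    (m2 : probability T2 R) (B : set (T1 * T2)) : measurable B ->
  measurable_fun setT (fun x => fine (m2 [set y | B (x, y)])).
Proof.
move=> mB; have -> : (fun x => fine (m2 [set y | B (x, y)])) =
    fine \o (m2 \o xsection B).
  apply/funext => x /=; congr (fine (m2 _)).
  by apply/seteqP; split=> y; rewrite /xsection /= inE.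
by apply: measurableT_comp => //; exact: measurable_fun_xsection.
Qed.

Lemma measurable_xsection_set d1 d2 (T1 : measurableType d1)
    (T2 : measurableType d2) (B : set (T1 * T2)) x : measurable B ->
  measurable [set y | B (x, y)].
Proof.
move=> mB; have -> : [set y | B (x, y)] = xsection B x.
  by apply/seteqP; split=> y; rewrite /xsection /= inE.
exact: measurable_xsection.
Qed.

End probability_of_sets.

Section cesaro_averages.
Context (R : realType) (G : topGroupType) (U : nat -> set G).
Hypothesis HU : countable_base U.
Context (mu : probability (borel G) R) (dW : measure_display)
  (W : measurableType dW) (PW : probability W R)
  (h : nat -> {mfun W >-> borel G}).
Hypothesis h_iid : is_iid PW mu h.
Hypothesis mu_null : forall (g : G) (A : set (borel G)), measurable A ->
  mu A = 0%E -> mu [set x | A (g * (x : G))%g] = 0%E.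
Notation M := (incr_law PW h).

Definition position k (w : incr G) : borel G := (\prod_(i < k.+1) w i)%g.
Let position_measurable k : measurable_fun setT (position k).
Proof.
have := measurable_partial_prod HU k.+1
  (@measurable_cst _ _ (incr G) _ setT (1%g : borel G)) (@measurable_id _ _ setT).
by congr (measurable_fun _ _); apply/funext => w; rewrite /= mul1g.
Qed.
HB.instance Definition _ k :=
  isMeasurableFun.Build _ _ _ _ (position k) (position_measurable k).

(** The mean of the first n.+1 convolution powers of mu. *)
Definition cesaro n : set (borel G) -> \bar R :=
  mscale (n.+1%:R^-1)%:nng (msum (fun k => distribution M (position k)) n.+1).
HB.instance Definition _ n := Measure.on (cesaro n).

Lemma cesaroE n (A : set (borel G)) : measurable A ->
  fine (cesaro n A) =
  n.+1%:R^-1 * \sum_(k < n.+1) fine (M (position k @^-1` A)).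
Proof.
move=> mA; rewrite /cesaro /mscale /= /msum.
rewrite (eq_bigr (fun k : 'I_n.+1 => (fine (M (position k @^-1` A)))%:E)).
  by rewrite sumEFin.
by move=> k _; exact/esym/(fineK_probability (distribution M (position k)) mA).
Qed.

Let cesaro_setT n : cesaro n setT = 1%E.
Proof.
rewrite /cesaro /mscale /= /msum (eq_bigr (fun=> 1%:E)) => [|k _].
  by rewrite sumEFin sumr_const card_ord -EFinM mulVf.
exact: (probability_setT (distribution M (position k))).
Qed.
HB.instance Definition _ n :=
  Measure_isProbability.Build _ _ _ (cesaro n) (cesaro_setT n).

(** The convolution powers of mu are absolutely continuous with respect to mu,
    because the translates of mu are. *)
Lemma position_null k (A : set (borel G)) : measurable A -> mu A = 0%E ->
  M (position k @^-1` A) = 0%E.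
Proof.
have mp j (B : set (borel G)) : measurable B -> measurable (position j @^-1` B).
  by move=> mB; rewrite -[_ @^-1` _]setTI; exact: (position_measurable j measurableT mB).
have pos0 x (w : incr G) : position 0 (incr_cons (x, w)) = x.
  by rewrite /position big_ord1.
have posS j x (w : incr G) :
    position j.+1 (incr_cons (x, w)) = ((x : G) * (position j w : G))%g.
  by rewrite /position big_ord_recl; congr (_ * _)%g; apply: eq_bigr.
elim: k A => [|k IH] A mA A0;
  rewrite (incr_law_cons h_iid) /product_measure1; try exact: mp.
  transitivity (\int[mu]_x (\1_A x)%:E)%E; last by rewrite integral_indic// setIT.
  apply: eq_integral => x _ /=; rewrite indicE.
  have [xA|xA] := boolP (x \in A).
    rewrite -[RHS](probability_setT M); congr (M _); apply/seteqP; split=> // w _.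
    by rewrite /xsection /= inE /= pos0; exact: set_mem.
  rewrite -[RHS](measure0 M); congr (M _); apply/seteqP; split=> // w.
  by rewrite /xsection /= inE /= pos0 => /mem_set; rewrite (negPf xA).
transitivity (\int[mu]_x (cst 0%E x : \bar R))%E; last by rewrite integral0.
apply: eq_integral => x _ /=.
have -> : xsection (@incr_cons G @^-1` (position k.+1 @^-1` A)) x =
    position k @^-1` [set y | A ((x : G) * (y : G))%g].
  by apply/seteqP; split=> w; rewrite /xsection /= inE /= posS.
apply: IH; last exact: mu_null.
by rewrite -[[set _ | _]]setTI; exact: (measurable_lmulg HU x measurableT mA).
Qed.

Lemma cesaro_null n (A : set (borel G)) : measurable A -> mu A = 0%E ->
  cesaro n A = 0%E.
Proof.
move=> mA A0; rewrite -(fineK_probability (cesaro n) mA) cesaroE// big1 ?mulr0//.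
by move=> k _; rewrite position_null.
Qed.

Section along_walk.
Variable H : closedSubgroup G.
Notation X := (rcoset_space H).

Definition frequency (B : set X) n (y : traj H) : R :=
  n.+1%:R^-1 * \sum_(k < n.+1) \1_B (y k).

Lemma almost_invariant_frequency (B : set (borel X)) n : measurable B ->
  almost_invariant n (frequency B n).
Proof.
move=> mB.
have n0 : (0 : R) < n.+1%:R^-1 by rewrite invr_gt0.
have i1 q : 0 <= (\1_B q : R) <= 1.
  by rewrite indicE; case: (_ \in _); rewrite ?lexx ?ler01.
split.
- apply: measurable_funM => //; apply: measurable_sum => k.
  have mi : measurable_fun setT (\1_B : borel X -> R) by exact: measurable_indic.
  exact: (measurableT_comp mi (@measurable_traj_coord G H k)).
- move=> y; rewrite /frequency normrM gtr0_norm// mulrC ler_pdivrMr// mul1r.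
  rewrite ger0_norm ?sumr_ge0// (_ : n.+1%:R = \sum_(k < n.+1) (1 : R));
    last by rewrite sumr_const card_ord.
  by apply: ler_sum => k _; have /andP[] := i1 (y k).
- move=> y; rewrite /frequency -mulrBr normrM gtr0_norm// mulrC ler_pM2r//.
  pose s : R := \sum_(k < n) \1_B (y k.+1).
  have -> : \sum_(k < n.+1) \1_B (Defs.shift y k) = s + \1_B (y n.+1).
    by rewrite big_ord_recr.
  have -> : \sum_(k < n.+1) \1_B (y k) = \1_B (y 0%N) + s.
    by rewrite big_ord_recl.
  have -> : s + \1_B (y n.+1) - (\1_B (y 0%N) + s) = \1_B (y n.+1) - \1_B (y 0%N).
    by ring.
  by have /andP[] := i1 (y n.+1); have /andP[] := i1 (y 0%N); rewrite ler_norml; lra.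
Qed.

(** This turns averages over the group into integrals over trajectories of almost
    invariant functions. *)
Lemma frequency_walk (B : set (borel X)) n g : measurable B ->
  \int[M]_w frequency B n (walk H g w) =
  fine (cesaro n [set x : borel G | B (\pi_X (g * (x : G))%g)]).
Proof.
move=> mB.
have mw x : measurable_fun setT (fun w : incr G => walk H x w).
  exact: (@measurable_walk _ _ HU H _ (incr G) (fun=> x) id).
pose A k := [set w : incr G | B (walk H g w k)].
have mA k : measurable (A k).
  rewrite -[A k]setTI.
  exact: (measurableT_comp (@measurable_traj_coord G H k) (mw g) measurableT mB).
rewrite cesaroE; last first.
  rewrite -[[set _ | _]]setTI.
  exact: (measurableT_comp (@measurable_pi _ H) (measurable_lmulg HU g)
    measurableT mB).
transitivity (\int[M]_w (n.+1%:R^-1 * \sum_(k < n.+1) \1_(A k) w)).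
  by [].
rewrite RintegralZl//; first by rewrite Rintegral_sum_indic.
apply: (@bounded_integrable _ _ _ _ _ n.+1%:R) => [|x].
  by apply: measurable_sum => k; exact: measurable_indic.
rewrite ger0_norm ?sumr_ge0// (_ : n.+1%:R = \sum_(k < n.+1) (1 : R));
  last by rewrite sumr_const card_ord.
apply: ler_sum => k _.
by rewrite indicE; case: (_ \in _).
Qed.

End along_walk.
End cesaro_averages.

(** * Defect of invariance and mass transport *)

Section defect.
Context (R : realType) (G : topGroupType) (U : nat -> set G).
Hypothesis HU : countable_base U.
Variable theta : probability (borel G) R.
Notation cd := (code U).

Lemma measurable_code_set m (H : subG G) (g : G) t :
  measurable [set x : borel G | cd m H (g * (x : G))%g = t].
Proof.
exact: (measurable_code HU t (measurable_lmulg HU g)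
  (@measurable_cst _ _ (borel G) _ setT H)).
Qed.

Definition excess g m (H : subG G) (t : {ffun 'I_m -> bool}) : R :=
  fine (theta [set x : borel G | cd m H (g * (x : G))%g = t]) -
  fine (theta [set x : borel G | cd m H x = t]).

(** The points whose code has positive excess form a set on which the difference
    of the translate of theta and theta is maximal among the sets read off from
    the code. This gives a maximizer that depends measurably on g and H. *)
Definition favored g m (H : subG G) (x : G) := 0 < excess g H (cd m H x).

Definition defect g m (H : subG G) : R :=
  fine (theta [set x : borel G | favored g m H (g * (x : G))%g]) -
  fine (theta [set x : borel G | favored g m H x]).

Let code_set1 m (H : subG G) t : measurable [set x : borel G | cd m H x = t].
Proof.
have := measurable_code_set H 1%g t.
by under [X in measurable X]eq_set do rewrite mul1g.
Qed.

Lemma measurable_code_in m (H : subG G) (S : {set {ffun 'I_m -> bool}}) g :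
  measurable [set x : borel G | cd m H (g * (x : G))%g \in S].
Proof.
exact: (fine_probability_fibers theta S (fun t => measurable_code_set H g t)).1.
Qed.

Lemma measurable_code_in1 m (H : subG G) (S : {set {ffun 'I_m -> bool}}) :
  measurable [set x : borel G | cd m H x \in S].
Proof. exact: (fine_probability_fibers theta S (fun t => code_set1 H t)).1. Qed.

Lemma sum_excess g m (H : subG G) (S : {set {ffun 'I_m -> bool}}) :
  fine (theta [set x : borel G | cd m H (g * (x : G))%g \in S]) -
  fine (theta [set x : borel G | cd m H x \in S]) = \sum_(t in S) excess g H t.
Proof.
rewrite (fine_probability_fibers theta S (fun t => measurable_code_set H g t)).2.
rewrite (fine_probability_fibers theta S (fun t => code_set1 H t)).2.
by rewrite -sumrB.
Qed.

Lemma defectE g m (H : subG G) :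
  defect g m H = \sum_(t : {ffun 'I_m -> bool} | 0 < excess g H t) excess g H t.
Proof.
pose S := finset (fun t : {ffun 'I_m -> bool} => 0 < excess g H t).
transitivity (\sum_(t in S) excess g H t); last first.
  by apply: eq_bigl => t; rewrite inE.
rewrite -sum_excess; congr (fine (theta _) - fine (theta _)).
  by apply/seteqP; split=> x /=; rewrite inE.
by apply/seteqP; split=> x /=; rewrite inE.
Qed.

Lemma defect_ge g m (H : subG G) (S : {set {ffun 'I_m -> bool}}) :
  fine (theta [set x : borel G | cd m H (g * (x : G))%g \in S]) -
  fine (theta [set x : borel G | cd m H x \in S]) <= defect g m H.
Proof.
rewrite sum_excess defectE big_mkcond [leRHS]big_mkcond; apply: ler_sum => t _.
by case: ifP => _; case: ltP => // /ltW.
Qed.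

Lemma defect_ge0 g m (H : subG G) : 0 <= defect g m H.
Proof. by rewrite defectE; apply: sumr_ge0 => t /ltW. Qed.

Lemma defect_le1 g m (H : subG G) : defect g m H <= 1.
Proof.
pose S := finset (fun t : {ffun 'I_m -> bool} => 0 < excess g H t).
have -> : defect g m H = \sum_(t in S) excess g H t.
  by rewrite defectE; apply: eq_bigl => t; rewrite inE.
rewrite -sum_excess.
have := fine_probability_itv theta (measurable_code_in H S g).
have := fine_probability_itv theta (measurable_code_in1 H S).
by lra.
Qed.

(** A code of length m is a function of the code of length m.+1. *)
Lemma defect_nd g (H : subG G) :
  nondecreasing_seq (fun m => defect g m H).
Proof.
apply/nondecreasing_seqP => m.
pose r (t : {ffun 'I_m.+1 -> bool}) : {ffun 'I_m -> bool} :=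
  [ffun i => t (widen_ord (leqnSn m) i)].
have rcode x : r (cd m.+1 H x) = cd m H x by apply/ffunP => i; rewrite !ffunE.
pose S := finset (fun t : {ffun 'I_m.+1 -> bool} => 0 < excess g H (r t)).
apply: le_trans (defect_ge g H S); rewrite le_eqVlt; apply/orP; left; apply/eqP.
congr (fine (theta _) - fine (theta _)).
  by apply/seteqP; split=> x /=; rewrite inE rcode.
by apply/seteqP; split=> x /=; rewrite inE rcode.
Qed.

Section measurability_along_points.
Context d (T : measurableType d) (a : T -> borel G) (L : T -> subG G).
Hypotheses (ma : measurable_fun setT a) (mL : measurable_fun setT L).

Let code_prod m t : measurable [set p : T * borel G | cd m (L p.1) p.2 = t].
Proof.
exact: (measurable_code HU t measurable_snd (measurableT_comp mL measurable_fst)).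
Qed.

Let code_prod_shift m t : measurable
  [set p : T * borel G | cd m (L p.1) ((a p.1 : G) * (p.2 : G))%g = t].
Proof.
apply: (measurable_code HU t _ (measurableT_comp mL measurable_fst)).
exact: (measurable_mulg HU (measurableT_comp ma measurable_fst) measurable_snd).
Qed.

Lemma measurable_excess m t :
  measurable_fun setT (fun w => @excess (a w) m (L w) t : R).
Proof.
apply: measurable_funB.
- exact: (measurable_section theta (code_prod_shift t)).
- exact: (measurable_section theta (code_prod t)).
Qed.

Lemma measurable_favored m (y : T -> G) :
  (forall t, measurable [set w | cd m (L w) (y w) = t]) ->
  measurable [set w | favored (a w) m (L w) (y w)].
Proof.
move=> my.
have -> : [set w | favored (a w) m (L w) (y w)] =
    \bigcup_(t in [set: {ffun 'I_m -> bool}])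
      ([set w | cd m (L w) (y w) = t] `&` [set w | 0 < excess (a w) (L w) t]).
  apply/seteqP; split=> [w fw|w [t _ [/= <-]]]; last by [].
  by exists (cd m (L w) (y w)).
apply: fin_bigcup_measurable => // t _; apply: measurableI => //.
rewrite -[X in measurable X]setTI.
have := measurable_excess t measurableT (measurable_itv `]0, +oo[).
by congr (measurable (_ `&` _)); apply/seteqP; split=> w /=; rewrite in_itv /= andbT.
Qed.

End measurability_along_points.

Section joint_measurability.
Context d (T : measurableType d) (a : T -> borel G) (L : T -> subG G).
Hypotheses (ma : measurable_fun setT a) (mL : measurable_fun setT L).

Lemma measurable_favored_shift m : measurable
  [set p : T * borel G | favored (a p.1) m (L p.1) ((a p.1 : G) * (p.2 : G))%g].
Proof.
have ma1 := measurableT_comp ma (@measurable_fst _ _ T (borel G)).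
have mL1 := measurableT_comp mL (@measurable_fst _ _ T (borel G)).
apply: (measurable_favored ma1 mL1) => t.
apply: (measurable_code HU t _ mL1).
exact: (measurable_mulg HU ma1 measurable_snd).
Qed.

Lemma measurable_favored_pair m : measurable
  [set p : T * borel G | favored (a p.1) m (L p.1) p.2].
Proof.
have ma1 := measurableT_comp ma (@measurable_fst _ _ T (borel G)).
have mL1 := measurableT_comp mL (@measurable_fst _ _ T (borel G)).
apply: (measurable_favored ma1 mL1) => t.
exact: (measurable_code HU t measurable_snd mL1).
Qed.

Lemma measurable_defect m : measurable_fun setT (fun w => defect (a w) m (L w)).
Proof.
apply: measurable_funB.
- exact: (measurable_section theta (measurable_favored_shift m)).
- exact: (measurable_section theta (measurable_favored_pair m)).
Qed.

End joint_measurability.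

Section mass_transport.
Context d (T : measurableType d) (P : probability T R) (K : T -> subG G).
Hypothesis mK : measurable_fun setT K.
Hypothesis K_invariant : forall (y : G) (A : set (subG G)), measurable A ->
  P [set w | A (csg_conj y (K w))] = P [set w | A (K w)].

(** For fixed x the law of K is that of its conjugate by (g x)^-1, and theta does
    not depend on K, so the order of integration may be exchanged. As
    x (x^-1 K x) = K x, this turns functions of cosets xK into functions of
    cosets Kx. *)
Lemma mass_transport (A : set (subG G * borel G)) (g : borel G -> borel G) :
  measurable_fun setT g -> measurable A ->
  \int[P]_w fine (theta [set x : borel G | A (K w, (g x))]) =
  \int[P]_w fine (theta [set x : borel G |
     A (csg_conj (g x : G)^-1%g (K w), (g x))]).
Proof.
move=> mg0 mA.
have mg : measurable_fun setT (fun p : T * borel G => g p.2).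
  exact: (measurableT_comp mg0 measurable_snd).
have mK1 := measurableT_comp mK (@measurable_fst _ _ T (borel G)).
pose B1 := [set p : T * borel G | A (K p.1, (g p.2))].
pose B2 := [set p : T * borel G |
  A (csg_conj (g p.2 : G)^-1%g (K p.1), (g p.2))].
have mB1 : measurable B1.
  rewrite -[B1]setTI; exact: (measurable_fun_pair mK1 mg measurableT mA).
have mB2 : measurable B2.
  rewrite -[B2]setTI.
  exact: (measurable_fun_pair (measurable_csg_conj HU mg mK1) mg measurableT mA).
have fK (B : set (T * borel G)) : measurable B ->
    \int[P]_w fine (theta [set x | B (w, x)]) =
    fine (\int[theta]_x P [set w | B (w, x)])%E.
  move=> mB; rewrite -tonelli_set//; congr fine; apply: eq_integral => w _.
  by rewrite fineK_probability//; exact: measurable_xsection_set.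
rewrite (fK _ mB1) (fK _ mB2); congr fine; apply: eq_integral => x _ /=.
rewrite /B1 /B2 /= -(K_invariant (g x : G)^-1%g (A := [set L | A (L, (g x))]))//.
have := measurable_ysection (g x) mA.
by congr measurable; apply/seteqP; split=> L; rewrite /ysection /= inE.
Qed.

(** In each integral of the defect, H is replaced by its conjugate by the inverse
    of the point at which the integrand is evaluated. The integrands are then
    functions of the coset of that point in H \ G. *)
Definition transported g m (H : subG G) : R :=
  fine (theta [set x : borel G | favored g m (csg_conj (g * (x : G))^-1%g H)
     (g * (x : G))%g]) -
  fine (theta [set x : borel G | favored g m (csg_conj (x : G)^-1%g H) x]).

Lemma measurable_transported_sets g m :
  measurable [set p : T * borel G | favored g m
     (csg_conj (g * (p.2 : G))^-1%g (K p.1)) (g * (p.2 : G))%g] /\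
  measurable [set p : T * borel G | favored g m
     (csg_conj (p.2 : G)^-1%g (K p.1)) p.2].
Proof.
have mg : measurable_fun setT (fun p : T * borel G => (g * (p.2 : G))%g : borel G).
  exact: (measurableT_comp (measurable_lmulg HU g) measurable_snd).
have mK1 := measurableT_comp mK (@measurable_fst _ _ T (borel G)).
have mc : measurable_fun setT (fun _ : T * borel G => g : borel G).
  exact: measurable_cst.
split.
- have mL := measurable_csg_conj HU mg mK1.
  by apply: (measurable_favored mc mL) => t; exact: (measurable_code HU t mg mL).
- have mL := measurable_csg_conj HU measurable_snd mK1.
  by apply: (measurable_favored mc mL) => t;
    exact: (measurable_code HU t measurable_snd mL).
Qed.

Lemma mean_defect g m :
  \int[P]_w defect g m (K w) = \int[P]_w transported g m (K w).
Proof.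
pose A := [set p : subG G * borel G | favored g m p.1 p.2].
have mA : measurable A.
  exact: (@measurable_favored_pair _ (subG G) (fun=> g) id).
have mg : measurable_fun setT (fun _ : T => g : borel G) by exact: measurable_cst.
have [mt1 mt2] := measurable_transported_sets g m.
have int (B : set (T * borel G)) : measurable B ->
    P.-integrable setT (EFin \o (fun w => fine (theta [set x | B (w, x)]))).
  move=> mB; apply: (@bounded_integrable _ _ _ _ _ 1).
    exact: measurable_section.
  move=> w; have := fine_probability_itv theta (measurable_xsection_set w mB).
  by rewrite ler_norml; lra.
rewrite /defect /transported.
rewrite RintegralB//; [|exact: (int _ (measurable_favored_shift mg mK m))
  |exact: (int _ (measurable_favored_pair mg mK m))].
rewrite RintegralB//; [|exact: (int _ mt1)|exact: (int _ mt2)].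
by congr (_ - _); [exact: (mass_transport (measurable_lmulg HU g) mA)
  |exact: (@mass_transport A id (@measurable_id _ _ setT) mA)].
Qed.

End mass_transport.
End defect.

(** * The defect tends to 0 *)

Lemma csg_eq (G : topGroupType) (H1 H2 : closedSubgroup G) :
  csg_set H1 = csg_set H2 -> H1 = H2.
Proof.
case: H1 H2 => [A1 c1 o1 m1 v1] [A2 c2 o2 m2 v2] /= A12.
case: _ / A12 in c2 o2 m2 v2 *.
by congr ClosedSubgroup; exact: Prop_irrelevance.
Qed.

Section conjugates_along_cosets.
Context (G : topGroupType) (U : nat -> set G).
Hypothesis HU : countable_base U.
Variable H : closedSubgroup G.
Notation X := (rcoset_space H).

(** The subgroup x^-1 H x, as a function of the coset Hx. *)
Definition coset_conj (q : X) : subG G := csg_conj (repr q)^-1%g H.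

Lemma repr_pi_rcoset (x : G) :
  exists2 k, csg_set H k & repr (\pi_X x : X) = (k * x)%g.
Proof.
case: piP => y /eqquotP /asboolP xy.
exists (y * x^-1)%g; last by rewrite mulgVK.
by have := csgV xy; rewrite invgM invgK.
Qed.

Lemma coset_conj_pi (x : G) : coset_conj (\pi_X x) = csg_conj x^-1%g H.
Proof.
rewrite /coset_conj; have [k Hk ->] := repr_pi_rcoset x.
have conjE (y z : G) : csg_set (csg_conj y^-1%g H) z = csg_set H (y * z * y^-1)%g.
  by rewrite /= /conj_set /= conjgE invgK mulgA.
apply: csg_eq; apply/seteqP; split=> z; rewrite !conjE invgM.
  move=> /(csgM (csgV Hk)) /csgM /(_ Hk).
  by rewrite !mulgA mulVg mul1g mulgVK.
by move=> /(csgM Hk) /csgM /(_ (csgV Hk)); rewrite !mulgA.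
Qed.

Lemma code_conj m (x : G) (i : 'I_m) :
  code U m (csg_conj x^-1%g H) x i = `[< exists2 k, csg_set H k & U i (k * x)%g >].
Proof.
rewrite ffunE; apply/asbool_equiv_eq; split=> -[k Hk Uk].
  exists (x * k * x^-1)%g; last by rewrite mulgVK.
  by move: Hk; rewrite /= /conj_set /= conjgE invgK mulgA.
exists (x^-1 * k * x)%g; last by rewrite !mulgA mulgV mul1g.
by rewrite /= /conj_set /= conjgE invgK !mulgA mulgV mul1g mulgK.
Qed.

(** The code of x with respect to x^-1 H x is a function of the coset Hx, although
    in general the code of x with respect to a fixed subgroup is not. *)
Lemma code_coset_conj m (x : G) :
  code U m (coset_conj (\pi_X x)) (repr (\pi_X x : X)) =
  code U m (csg_conj x^-1%g H) x.
Proof.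
apply/ffunP => i; rewrite [in LHS]/coset_conj !code_conj.
have [h Hh ->] := repr_pi_rcoset x.
apply/asbool_equiv_eq; split=> -[k Hk Uk].
  by exists (k * h)%g; [exact: csgM|rewrite -mulgA].
by exists (k * h^-1)%g; [exact/csgM/csgV|rewrite mulgA mulgVK].
Qed.

Lemma measurable_coset_conj :
  measurable_fun setT (coset_conj : borel X -> subG G).
Proof.
apply: measurable_hits => V oV; apply: open_borel.
rewrite /open /= /quotient_open.
have -> : \pi_X @^-1` [set q | csg_set (coset_conj q) `&` V !=set0] =
    \bigcup_(k in csg_set H) [set x : G | V (x^-1 * k * x)%g].
  apply/seteqP; split=> x; rewrite /preimage /mkset coset_conj_pi.
    move=> [y [/= Hy Vy]]; exists (x * y * x^-1)%g.
      by move: Hy; rewrite /conj_set /= conjgE invgK mulgA.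
    by rewrite /= !mulgA mulVg mul1g mulgVK.
  move=> [k Hk /= Vk]; exists (x^-1 * k * x)%g; split => //=.
  by rewrite /conj_set /= conjgE invgK !mulgA mulgV mul1g mulgK.
apply: bigcup_open => k _; apply: open_comp oV => x _.
have cid : continuous (fun x : G => x) by move=> y; exact: cvg_id.
have cst_ : continuous (fun _ : G => k) by move=> y; exact: cvg_cst.
exact: (continuousM (continuousM (continuousV cid) cst_) cid).
Qed.

Lemma measurable_coset_code m (t : {ffun 'I_m -> bool}) :
  measurable [set q : borel X | code U m (coset_conj q) (repr (q : X)) = t].
Proof.
pose B (i : nat) := [set q : borel X |
  exists2 k, csg_set H k & U i (k * repr (q : X))%g].
have mB i : measurable (B i).
  apply: open_borel; rewrite /open /= /quotient_open.
  have -> : \pi_X @^-1` B i = \bigcup_(k in csg_set H) [set x : G | U i (k * x)%g].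
    apply/seteqP; split=> x; rewrite /preimage /B /=;
      have [h Hh ->] := repr_pi_rcoset x => -[k Hk Uk].
      by exists (k * h)%g; [exact: csgM|rewrite /= -mulgA].
    by exists (k * h^-1)%g; [exact/csgM/csgV|rewrite mulgA mulgVK].
  apply: bigcup_open => k _; apply: open_comp (HU.1 i) => x _.
  have cid : continuous (fun x : G => x) by move=> y; exact: cvg_id.
  have cst_ : continuous (fun _ : G => k) by move=> y; exact: cvg_cst.
  exact: (continuousM cst_ cid).
have -> : [set q : borel X | code U m (coset_conj q) (repr (q : X)) = t] =
    \bigcap_(i in [set: 'I_m]) (if t i then B i else ~` B i).
  apply/seteqP; split=> [q /= <- i _|q Bq /=].
    by rewrite code_conj; case: asboolP.
  apply/ffunP => i; have := Bq i Logic.I; rewrite code_conj.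
  by case: (t i) => [?|?]; [exact/asboolP|exact/asboolPn].
apply: fin_bigcap_measurable => // i _; case: (t i) => //; exact: measurableC.
Qed.

End conjugates_along_cosets.

Section defect_vanishes.
Context (R : realType) (G : topGroupType) (U : nat -> set G).
Hypothesis HU : countable_base U.
Context (mu : probability (borel G) R) (dW : measure_display)
  (W : measurableType dW) (PW : probability W R)
  (h : nat -> {mfun W >-> borel G}).
Hypothesis h_iid : is_iid PW mu h.
Hypothesis mu_null : forall (g : G) (A : set (borel G)), measurable A ->
  mu A = 0%E -> mu [set x | A (g * (x : G))%g] = 0%E.
Notation theta := (cesaro HU PW h).

(** The transported defect is the oscillation, between the walks started at g and
    at 1, of the frequency of visits to a Borel set of cosets Hx. The set depends
    on n, which is why a bound that is uniform in the functions is needed. *)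
Lemma transported_cvg0 (H : closedSubgroup G) (g : G) (m : nat -> nat) :
  trivial_boundary H PW h ->
  transported U (theta n) g (m n) H @[n --> \oo] --> (0 : R).
Proof.
move=> Htriv; apply/cvgrPdist_le => e e0.
have [N HN] := almost_invariant_oscillation HU h_iid mu_null Htriv g e0.
exists N => // n /= Nn; rewrite sub0r normrN.
pose B := [set q : borel (rcoset_space H) |
  favored U (theta n) g (m n) (coset_conj q) (repr (q : rcoset_space H))].
have mB : measurable B.
  apply: (measurable_favored HU (theta n) (a := fun=> g)) => //.
    exact: measurable_coset_conj.
  exact: measurable_coset_code.
have BE (x : G) :
    (favored U (theta n) g (m n) (csg_conj x^-1%g H) x : Prop) =
    B (\pi_(rcoset_space H) x).
  by rewrite /B /= /favored (code_coset_conj U) coset_conj_pi.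
have -> : transported U (theta n) g (m n) H =
    \int[incr_law PW h]_w frequency R B n (walk H g w) -
    \int[incr_law PW h]_w frequency R B n (walk H 1%g w).
  rewrite !(frequency_walk HU)//; congr (fine (theta n _) - fine (theta n _)).
    by apply/seteqP; split=> x /=; rewrite BE.
  by apply/seteqP; split=> x /=; rewrite BE mul1g.
have fN := almost_invariant_le Nn (@almost_invariant_frequency R _ H B n mB).
rewrite ler_norml; apply/andP; split; last exact/ltW/HN.
have := HN _ (almost_invariantN fN).
have iw x : (incr_law PW h).-integrable setT
    (EFin \o (fun w => frequency R B n (walk H x w))).
  have [mf f1 _] := fN; apply: (@bounded_integrable _ _ _ _ _ 1) => //.
  apply: (measurableT_comp mf).
  exact: (@measurable_walk _ _ HU H _ (incr G) (fun=> x) id).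
have iN x : \int[incr_law PW h]_w - frequency R B n (walk H x w) =
    - \int[incr_law PW h]_w frequency R B n (walk H x w).
  rewrite -[RHS]mulN1r -(RintegralZl (-1) measurableT (iw x)).
  by apply: eq_Rintegral => w _; rewrite mulN1r.
by rewrite !iN; lra.
Qed.

End defect_vanishes.

Section summable_defects.
Context (R : realType) (G : topGroupType) (U : nat -> set G).
Hypothesis HU : countable_base U.
Context (mu : probability (borel G) R) (dW : measure_display)
  (W : measurableType dW) (PW : probability W R)
  (h : nat -> {mfun W >-> borel G}).
Hypothesis h_iid : is_iid PW mu h.
Hypothesis mu_null : forall (g : G) (A : set (borel G)), measurable A ->
  mu A = 0%E -> mu [set x | A (g * (x : G))%g] = 0%E.
Context d (T : measurableType d) (P : probability T R) (K : T -> subG G).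
Hypothesis mK : measurable_fun setT K.
Hypothesis K_invariant : forall (y : G) (A : set (subG G)), measurable A ->
  P [set w | A (csg_conj y (K w))] = P [set w | A (K w)].
Hypothesis K_trivial : {ae P, forall w, trivial_boundary (K w) PW h}.
Notation theta := (cesaro HU PW h).
Notation defect n := (defect U (theta n)).

(** The bound is uniform in m because the worst m for each n may be chosen. *)
Lemma mean_defect_cvg0 (g : G) (e : R) : 0 < e ->
  \forall n \near \oo, forall m, \int[P]_w defect n g m (K w) <= e.
Proof.
move=> e0.
have /choice[m Hm] : forall n, exists m,
    (exists k, e < \int[P]_w defect n g k (K w)) ->
    e < \int[P]_w defect n g m (K w).
  move=> n; have [[k Hk]|no] := pselect (exists k, e < \int[P]_w defect n g k (K w)).
    by exists k.
  by exists 0%N => /no.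
have := @bounded_cvg _ _ _ P
  (fun n w => transported U (theta n) g (m n) (K w)) 0 1.
have mt n := measurable_transported_sets HU (theta n) mK g (m n).
have int01 n (B : set (T * borel G)) w : measurable B ->
    0 <= fine (theta n [set x | B (w, x)]) <= 1.
  by move=> mB; exact: fine_probability_itv (measurable_xsection_set w mB).
move=> /(_ _ _ _)/cvgrPdist_le /(_ e e0) H.
have {}H : \forall n \near \oo,
    `|0 - \int[P]_w transported U (theta n) g (m n) (K w)| <= e.
  apply: H => [n|n w|].
  - apply: measurable_funB.
      exact: (measurable_section (theta n) (mt n).1).
    exact: (measurable_section (theta n) (mt n).2).
  - have := int01 n _ w (mt n).1; have := int01 n _ w (mt n).2.
    by rewrite ler_norml /transported /=; lra.
  - apply: filterS K_trivial => w Kw.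
    exact: (transported_cvg0 HU h_iid mu_null g m Kw).
apply: filterS H => n; rewrite sub0r normrN -(mean_defect HU (theta n) mK K_invariant).
move=> He k; rewrite leNgt; apply/negP => ek.
have := Hm n (ex_intro _ k ek); rewrite ltNge => /negP; apply.
exact: le_trans (ler_norm _) He.
Qed.

(** Half the norm of the difference between the images in G / H of [theta n] and of
    its translate by g, see [translate_le_defect]. *)
Definition total_defect n g (H : subG G) : \bar R :=
  limn (fun m => (defect n g m H)%:E).

Lemma is_cvg_total_defect n g H : cvgn (fun m => (defect n g m H)%:E).
Proof.
apply: ereal_nondecreasing_is_cvgn => a b ab; rewrite lee_fin.
exact: (defect_nd HU (theta n) g H ab).
Qed.

Lemma defect_le_total n g m H : ((defect n g m H)%:E <= total_defect n g H)%E.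
Proof.
apply: lime_ge; first exact: is_cvg_total_defect.
exists m => // k mk; rewrite lee_fin; exact: (defect_nd HU (theta n) g H mk).
Qed.

Lemma total_defect_ge0 n g H : (0 <= total_defect n g H)%E.
Proof.
apply: le_trans (defect_le_total n g 0 H); rewrite lee_fin.
exact: defect_ge0.
Qed.

Lemma measurable_total_defect n d' (S : measurableType d') (a : S -> borel G)
    (L : S -> subG G) : measurable_fun setT a -> measurable_fun setT L ->
  measurable_fun setT (fun s => total_defect n (a s) (L s)).
Proof.
move=> ma mL.
apply: (emeasurable_fun_cvg (fun m s => (defect n (a s) m (L s))%:E)) => [m|s _].
  by apply/measurable_EFinP; exact: (measurable_defect HU (theta n) ma mL).
exact: is_cvg_total_defect.
Qed.

Lemma mean_total_defect_cvg0 (g : G) (e : R) : 0 < e ->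
  \forall n \near \oo, (\int[P]_w total_defect n g (K w) <= e%:E)%E.
Proof.
move=> e0; apply: filterS (mean_defect_cvg0 g e0) => n He.
have mg : measurable_fun setT (fun _ : T => g : borel G) by exact: measurable_cst.
have md m := measurable_defect HU (theta n) mg mK m.
have nd w : nondecreasing_seq (fun m => (defect n g m (K w))%:E).
  by move=> a b ab; rewrite lee_fin; exact: (defect_nd HU (theta n) g _ ab).
have d0 m w : (0 <= (defect n g m (K w))%:E)%E by rewrite lee_fin; exact: defect_ge0.
have mde m : measurable_fun setT (fun w => (defect n g m (K w))%:E).
  exact/measurable_EFinP.
rewrite /total_defect (monotone_convergence P measurableT mde) => //.
apply: lime_le.
  apply: ereal_nondecreasing_is_cvgn => a b ab.
  by apply: ge0_le_integral => // w _; exact: nd.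
apply: nearW => m; rewrite -[leLHS]fineK ?lee_fin//; first exact: He.
apply: (integrable_fin_num measurableT).
apply: (@bounded_integrable _ _ _ _ (fun w => defect n g m (K w)) 1) => // w.
by rewrite ger0_norm; [exact: defect_le1|exact: defect_ge0].
Qed.

Lemma total_defect_le1 n g H : (total_defect n g H <= 1)%E.
Proof.
apply: lime_le; first exact: is_cvg_total_defect.
by apply: nearW => m; rewrite lee_fin; exact: defect_le1.
Qed.

(** Summability along a subsequence turns convergence in mean into almost sure
    convergence; Fubini is needed twice since the exceptional null set of
    subgroups must not depend on g. *)
Lemma summable_defects : exists n : nat -> nat, {ae P, forall w, {ae mu, forall g,
  (\sum_(k <oo) total_defect (n k) g (K w) < +oo)%E}}.
Proof.
pose a n (g : borel G) := (\int[P]_w total_defect n g (K w))%E.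
pose F n (p : borel G * T) := total_defect n p.1 (K p.2).
have mF n : measurable_fun setT (F n).
  by apply: measurable_total_defect measurable_fst (measurableT_comp mK measurable_snd).
have F0 n p : (0 <= F n p)%E by exact: total_defect_ge0.
have ma n : measurable_fun setT (a n).
  exact: (measurable_fun_fubini_tonelli_F (m2 := P) (F n) (mF n) (F0 n)).
have a0 n g : (0 <= a n g)%E by apply: integral_ge0 => w _; exact: total_defect_ge0.
have mtd n g : measurable_fun setT (fun w => total_defect n g (K w)).
  exact: (measurable_total_defect n (a := fun=> g) (measurable_cst _) mK).
have a1 n g : (a n g <= 1)%E.
  apply: (@le_trans _ _ (\int[P]_w cst 1%E w)%E).
    apply: ge0_le_integral => // w _; [exact: total_defect_ge0|exact: total_defect_le1].
  by rewrite integral_cst//= probability_setT mule1.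
have af n g : (fine (a n g))%:E = a n g.
  by rewrite fineK// ge0_fin_numE// (le_lt_trans (a1 n g))// ltry.
have lim0 : (\int[mu]_g fine (a n g)) @[n --> \oo] --> (0 : R).
  apply: (@bounded_cvg _ _ _ mu _ 0 1) => [n|n g|].
  - exact: measurableT_comp.
  - by rewrite ger0_norm ?fine_ge0// -lee_fin af.
  - apply: aeW => g; apply/cvgrPdist_le => e e0.
    apply: filterS (mean_total_defect_cvg0 g e0) => n.
    by rewrite sub0r normrN ger0_norm ?fine_ge0// -lee_fin af.
have /choice[n Hn] : forall k, exists n,
    (\int[mu]_g a n g <= (1 / (2 ^ k.+1)%:R)%:E)%E.
  move=> k; have e0 : (0 : R) < 1 / (2 ^ k.+1)%:R by rewrite divr_gt0// ltr0n expn_gt0.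
  move/cvgrPdist_le : lim0 => /(_ _ e0)[N _ /(_ N (leqnn N))] /= HN; exists N.
  rewrite -[leLHS]fineK; last first.
    rewrite ge0_fin_numE ?integral_ge0//.
    apply: (@le_lt_trans _ _ (\int[mu]_w cst 1%E w)%E); last first.
      by rewrite integral_cst//= probability_setT mule1 ltry.
    by apply: ge0_le_integral.
  rewrite lee_fin; apply: le_trans HN; rewrite sub0r normrN.
  apply: le_trans (ler_norm _); rewrite /Rintegral.
  by under [in leRHS]eq_integral do rewrite af.
exists n.
have mG k : measurable_fun setT (fun w => \int[mu]_g total_defect (n k) g (K w))%E.
  exact: (measurable_fun_fubini_tonelli_G (m1 := mu) (F (n k)) (mF (n k)) (F0 (n k))).
have aeP := @ae_summable _ _ _ P (fun k w => \int[mu]_g total_defect (n k) g (K w))%E mG.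
apply: filterS (aeP _ _) => [w Hw|k w|].
- apply: ae_summable => // [k|k g]; last exact: total_defect_ge0.
  exact: (@measurable_total_defect _ _ (borel G) id (fun=> K w)).
- by apply: integral_ge0 => g _; exact: total_defect_ge0.
- apply: (@geometric_summable _ _ 1) => k.
    by apply: integral_ge0 => w _; apply: integral_ge0 => g _; exact: total_defect_ge0.
  apply: le_trans (Hn k).
  rewrite /a le_eqVlt; apply/orP; left; apply/eqP/esym.
  exact: (fubini_tonelli (m1 := mu) (m2 := P) (F (n k)) (mF (n k)) (F0 (n k))).
Qed.

End summable_defects.

(** * Borel sets of the space of cosets *)

Section approximation.
Context (R : realType) d (T : measurableType d) (rho : {measure set T -> \bar R}).
Hypothesis rho_fin : (rho setT < +oo)%E.
Variable A0 : set (set T).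
Hypotheses (A0m : A0 `<=` measurable) (A00 : A0 set0)
  (A0C : forall A, A0 A -> A0 (~` A))
  (A0U : forall A B, A0 A -> A0 B -> A0 (A `|` B)).

Definition setdelta (A B : set T) := (A `\` B) `|` (B `\` A).

Lemma measurable_setdelta A B :
  measurable A -> measurable B -> measurable (setdelta A B).
Proof. by move=> mA mB; apply: measurableU; exact: measurableD. Qed.

Definition approximable : set (set T) := [set B | measurable B /\
  forall e : R, 0 < e -> exists2 A, A0 A & (rho (setdelta A B) <= e%:E)%E].

Lemma approximable_base : A0 `<=` approximable.
Proof.
move=> A AA; split; first exact: A0m.
by move=> e e0; exists A => //; rewrite /setdelta setDv setU0 measure0 lee_fin ltW.
Qed.

Lemma approximable_sigma_algebra : sigma_algebra setT approximable.
Proof.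
split.
- exact: approximable_base.
- move=> B [mB aB]; rewrite setTD; split; first exact: measurableC.
  move=> e /aB[A AA Ae]; exists (~` A); first exact: A0C.
  rewrite (_ : setdelta _ _ = setdelta A B)// /setdelta.
  by rewrite !setDE !setCK setUC [in LHS]setIC [X in _ `|` X]setIC.
- move=> F HF; have mF i : measurable (F i) by have [] := HF i.
  have mUF : measurable (\bigcup_i F i) by exact: bigcupT_measurable.
  split=> // e e0.
  pose D n := (\bigcup_i F i) `\` \bigcup_(i < n) F i.
  have mD n : measurable (D n).
    by apply: measurableD => //; apply: bigcup_measurable.
  have D0 : \bigcap_n D n = set0.
    apply/seteqP; split=> // x Dx; have [[i _ Fx] _] := Dx 0%N I.
    by have [_] := Dx i.+1 I; apply; exists i => /=.
  have : (rho \o D) @ \oo --> rho (\bigcap_n D n).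
    apply: nonincreasing_cvg_mu => //.
    - apply: le_lt_trans rho_fin; apply: le_measure; rewrite ?inE//.
    - by rewrite D0.
    - move=> a b ab; apply/subsetPset => x [Ux nx]; split=> // -[i ia Fx].
      by apply: nx; exists i => //=; exact: leq_trans ia ab.
  rewrite D0 measure0 => /fine_cvgP[_ /cvgrPdist_le /(_ (e / 2))].
  have e2 : 0 < e / 2 by rewrite divr_gt0.
  move=> /(_ e2)[N _ /(_ N (leqnn N))] /=; rewrite sub0r normrN => DN.
  have rfin B : measurable B -> rho B \is a fin_num.
    move=> mB; rewrite ge0_fin_numE//; apply: le_lt_trans rho_fin.
    by apply: le_measure; rewrite ?inE.
  have DN' : (rho (D N) <= (e / 2)%:E)%E.
    by rewrite -(fineK (rfin _ (mD N))) lee_fin (le_trans (ler_norm _)).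
  have eN : 0 < e / 2 / N.+1%:R by rewrite divr_gt0.
  have /choice[A HA] : forall i, exists A, A0 A /\
      (rho (setdelta A (F i)) <= (e / 2 / N.+1%:R)%:E)%E.
    by move=> i; have [_ /(_ _ eN)[A AA Ae]] := HF i; exists A.
  have finU n : A0 (\big[setU/set0]_(i < n) A i) /\
      (rho (\big[setU/set0]_(i < n) setdelta (A i) (F i)) <=
       (\sum_(i < n) e / 2 / N.+1%:R)%:E)%E /\
      measurable (\big[setU/set0]_(i < n) setdelta (A i) (F i)).
    elim: n => [|n [IH1 [IH2 IH3]]].
      by rewrite !big_ord0 measure0.
    have md : measurable (setdelta (A n) (F n)).
      by apply: measurable_setdelta => //; apply: A0m; exact: (HA n).1.
    rewrite !big_ord_recr /=; split; first by apply: A0U => //; exact: (HA n).1.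
    split; last exact: measurableU.
    apply: le_trans (measureU2 _ _ _) _ => //.
    by rewrite EFinD; apply: leeD => //; exact: (HA n).2.
  have [AN [ANe mdN]] := finU N.
  exists (\big[setU/set0]_(i < N) A i) => //.
  apply: (@le_trans _ _ (rho (D N `|` \big[setU/set0]_(i < N) setdelta (A i) (F i)))).
    apply: le_measure; rewrite ?inE.
    + apply: measurable_setdelta => //; exact: A0m.
    + exact: measurableU.
    + rewrite -(bigcup_mkord N A) -(bigcup_mkord N (fun i => setdelta (A i) (F i))).
      move=> x [[[i /= iN Ax] nFx]|[[i _ Fx] nAx]].
        by right; exists i => //; left; split=> // Fx; apply: nFx; exists i.
      have [[j jN Fjx]|nF] := pselect ((\bigcup_(i < N) F i) x).
        by right; exists j => //; right; split=> // Ax; apply: nAx; exists j.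
      by left; split => //; exists i.
  apply: le_trans (measureU2 _ _ _) _ => //.
  rewrite [e in leRHS]splitr EFinD; apply: leeD.
    exact: DN'.
  apply: le_trans ANe _; rewrite lee_fin sumr_const card_ord -(mulr_natr _ N).
  rewrite -(mulrA (e / 2)) -[leRHS]mulr1 ler_pM2l// mulrC.
  by rewrite ler_pdivrMr// mul1r ler_nat.
Qed.

End approximation.

Section saturated_sets.
Context (R : realType) (G : topGroupType) (U : nat -> set G).
Hypothesis HU : countable_base U.
Variables (theta : probability (borel G) R) (H : closedSubgroup G) (g : G).
Notation Y := (lcoset_space H).

Definition code_sets : set (set (borel G)) := [set A | exists m,
  exists S : {set {ffun 'I_m -> bool}}, A = [set x : borel G | code U m H x \in S]].

Lemma code_sets_measurable : code_sets `<=` measurable.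
Proof. by move=> _ [m [S ->]]; exact: (measurable_code_in1 HU theta). Qed.

Lemma code_widen m n (mn : (m <= n)%N) (x : G) :
  [ffun i => code U n H x (widen_ord mn i)] = code U m H x.
Proof. by apply/ffunP => i; rewrite !ffunE. Qed.

Lemma code_setsU A B : code_sets A -> code_sets B -> code_sets (A `|` B).
Proof.
move=> [m [S ->]] [n [S' ->]].
pose r (k l : nat) (kl : (k <= l)%N) (t : {ffun 'I_l -> bool}) : {ffun 'I_k -> bool} :=
  [ffun i => t (widen_ord kl i)].
exists (maxn m n), (finset (fun t =>
  (r _ _ (leq_maxl m n) t \in S) || (r _ _ (leq_maxr m n) t \in S'))).
apply/seteqP; split=> x /=; rewrite inE /r !code_widen.
  by move=> [->|->]; rewrite ?orbT.
by move=> /orP.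
Qed.

(** The preimage of an open set of G / H is the union of the saturations U_i H
    with U_i contained in it, so it is approximable. *)
Lemma approximable_borel (rho : {measure set (borel G) -> \bar R})
    (B : set (borel Y)) : (rho setT < +oo)%E -> measurable B ->
  approximable rho code_sets ((\pi_Y : G -> Y) @^-1` B).
Proof.
move=> rfin.
have sa : sigma_algebra setT (approximable rho code_sets).
  apply: approximable_sigma_algebra => //.
  - exact: code_sets_measurable.
  - exists 0%N, finset.set0.
    by apply/seteqP; split=> x //=; rewrite inE.
  - move=> _ [m [S ->]]; exists m, (finset.setC S).
    by apply/seteqP; split=> x /=; rewrite inE => /negP.
  - exact: code_setsU.
apply: (smallest_sub (X := [set B : set Y |
    approximable rho code_sets ((\pi_Y : G -> Y) @^-1` B)]) (C := sigma_algebra setT)).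
  case: sa => s0 sC sU; split.
  - by rewrite /= preimage_set0.
  - by move=> A /sC; rewrite !setTD.
  - by move=> F HF; rewrite /= preimage_bigcup; exact: sU.
move=> A oA /=.
have oA' : open ((\pi_Y : G -> Y) @^-1` A).
  exact: (continuousP _).1 (@pi_continuous _ _) _ oA.
pose V i : set (borel G) := if `[< U i `<=` (\pi_Y : G -> Y) @^-1` A >] then
  [set x : borel G | exists2 k, csg_set H k & U i ((x : G) * k)%g] else set0.
have -> : (\pi_Y : G -> Y) @^-1` A = \bigcup_i V i.
  apply/seteqP; split=> x.
    move=> Ax; have /HU.2[i Uix UA] : nbhs (x : G) ((\pi_Y : G -> Y) @^-1` A).
      exact: open_nbhs_nbhs.
    exists i => //; rewrite /V asboolT//; exists 1%g; first exact: csg1.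
    by rewrite mulg1.
  move=> [i _]; rewrite /V; case: asboolP => // UA [k Hk /UA].
  rewrite /preimage /= (_ : \pi_Y (x * k)%g = \pi_Y x)//.
  by apply/eqquotP/asboolP; rewrite invgM -mulgA mulVg mulg1; exact: csgV.
case: sa => s0 sC sU; apply: sU => i; rewrite /V; case: asboolP => // _.
apply: approximable_base; first exact: code_sets_measurable.
exists i.+1, (finset (fun t : {ffun 'I_i.+1 -> bool} => t ord_max)).
by apply/seteqP; split=> x /=; rewrite inE ffunE => /asboolP.
Qed.

(** By approximation with respect to the sum of theta and its translate, the
    defects control the difference of the two on all Borel sets of G / H. *)
Lemma translate_le_defect (B : set (borel Y)) (e : R) : measurable B -> 0 < e ->
  exists m, fine (theta [set x : borel G | B (\pi_Y (g * (x : G))%g)]) -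
    fine (theta [set x : borel G | B (\pi_Y (x : G))]) <= defect U theta g m H + e.
Proof.
move=> mB e0.
pose lg (x : borel G) : borel G := (g * (x : G))%g.
pose lgm := isMeasurableFun.Build _ _ _ _ lg (measurable_lmulg HU g).
pose lgM : {mfun borel G >-> borel G} := HB.pack lg lgm.
pose theta_g : probability (borel G) R := distribution theta lgM.
pose rho := measure_add theta theta_g.
have rhoE A : rho A = (theta A + theta_g A)%E by exact: measure_addE.
have rfin : (rho setT < +oo)%E.
  by rewrite rhoE !probability_setT -EFinD ltry.
have [mpB /(_ e e0)[_ [m [S ->]] Ae]] := approximable_borel rfin mB.
set B' := _ @^-1` B in mpB Ae.
set A := [set x | _] in Ae.
have mA : measurable A by exact: (measurable_code_in1 HU theta).
have mAB := measurable_setdelta mA mpB.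
exists m; apply: le_trans (lerD (defect_ge HU theta g H S) (lexx e)).
have key (P : probability (borel G) R) :
    `|fine (P B') - fine (P A)| <= fine (P (setdelta A B')).
  have mAU := measurableU _ _ mA mAB; have mBU := measurableU _ _ mpB mAB.
  have h1 : fine (P B') <= fine (P A) + fine (P (setdelta A B')).
    rewrite -lee_fin EFinD !fineK_probability//.
    apply: le_trans (measureU2 _ _ _) => //; apply: le_measure; rewrite ?inE//.
    move=> x Bx; have [Ax|nAx] := pselect (A x); [by left|right].
    by right.
  have h2 : fine (P A) <= fine (P B') + fine (P (setdelta A B')).
    rewrite -lee_fin EFinD !fineK_probability//.
    apply: le_trans (measureU2 _ _ _) => //; apply: le_measure; rewrite ?inE//.
    move=> x Ax; have [Bx|nBx] := pselect (B' x); [by left|right].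
    by left.
  by rewrite ler_norml; lra.
have Ae' : fine (theta (setdelta A B')) + fine (theta_g (setdelta A B')) <= e.
  by rewrite -lee_fin EFinD !fineK_probability// -rhoE.
have := key theta; have := key theta_g.
rewrite !ler_norml => /andP[g1 g2] /andP[t1 t2].
have -> : [set x : borel G | B (\pi_Y (g * (x : G))%g)] = lg @^-1` B' by [].
have -> : [set x : borel G | code U m H (g * (x : G))%g \in S] = lg @^-1` A by [].
have -> : [set x : borel G | B (\pi_Y (x : G))] = B' by [].
rewrite -/A -[theta (lg @^-1` B')]/(theta_g B') -[theta (lg @^-1` A)]/(theta_g A).
lra.
Qed.

End saturated_sets.

(** * The invariant mean *)

Lemma ultra_cvg (R : realType) (F : set_system nat) (a : nat -> R) (M : R) :
  UltraFilter F -> (forall k, `|a k| <= M) -> cvg (a @ F).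
Proof.
move=> FU aM; have PF : ProperFilter F by exact: ultra_proper.
have [p [_ clp]] : [set` `[- M, M]] `&` cluster (a @ F) !=set0.
  apply: (@segment_compact R (- M) M (a @ F)).
  by apply: (@nearW _ F) => k; rewrite /= in_itv /= -ler_norml.
apply/cvg_ex; exists p => V Vp.
have [//|FV] := in_ultra_setVsetC (a @^-1` V) FU.
have [x [nVx Vx]] := clp (~` V) V FV Vp.
by have := nVx Vx.
Qed.

(** The number of positive integers j <= y, counted up to N, is the integral part
    of y when 0 <= y <= N. The first conjunct serves the induction. *)
Lemma staircase (R : realType) (y : R) N : 0 <= y ->
  (N%:R <= y -> \sum_(j < N) (j.+1%:R <= y)%R%:R = N%:R :> R) /\
  (y <= N%:R -> y - 1 <= \sum_(j < N) (j.+1%:R <= y)%R%:R <= y).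
Proof.
move=> y0; elim: N => [|N [IH1 IH2]].
  by rewrite big_ord0; split=> // yN; rewrite y0 lerBlDr add0r (le_trans yN)// ler01.
rewrite big_ord_recr /=; have [Ny|yN] := leP N.+1%:R y.
  have NS : N.+1%:R = N%:R + 1 :> R by rewrite -natr1.
  rewrite IH1; last by rewrite (le_trans _ Ny)// ler_nat.
  rewrite /= -NS; split=> // yN; move: yN Ny; move: (N.+1%:R) => t yt ty.
  by rewrite ty andbT; lra.
rewrite addr0; split; first by [].
move=> _; have [yN'|Ny] := leP y N%:R; first exact: IH2.
rewrite (IH1 (ltW Ny)) (ltW Ny) andbT lerBlDr natr1; exact: ltW.
Qed.

Section asymptotic_translation.
Context (R : realType) (G : topGroupType) (U : nat -> set G).
Hypothesis HU : countable_base U.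
Variables (H : closedSubgroup G) (th : nat -> probability (borel G) R) (g : G).
Notation Y := (lcoset_space H).
Notation pi x := (\pi_Y (x : G)).

Lemma measurable_lpi : measurable_fun setT ((fun x => pi x) : borel G -> borel Y).
Proof.
apply: measurable_borel => O oO; apply: open_borel.
exact: (continuousP _).1 (@pi_continuous _ _) _ oO.
Qed.

Lemma measurable_lpi_shift :
  measurable_fun setT ((fun x => pi (g * (x : G))%g) : borel G -> borel Y).
Proof. exact: (measurableT_comp measurable_lpi (measurable_lmulg HU g)). Qed.

Hypothesis th_g : forall B : set (borel Y), measurable B ->
  (fine (th k [set x | B (pi (g * (x : G))%g)]) - fine (th k [set x | B (pi x)]))
    @[k --> \oo] --> (0 : R).

Definition bounded_mfun (u : borel Y -> R) :=
  measurable_fun setT u /\ exists M, forall q, `|u q| <= M.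

Definition drift (u : borel Y -> R) k : R :=
  \int[th k]_x u (pi (g * (x : G))%g) - \int[th k]_x u (pi x).

Lemma integrable_bounded_mfun (P : probability (borel G) R) u : bounded_mfun u ->
  P.-integrable setT (EFin \o (fun x => u (pi (g * (x : G))%g))) /\
  P.-integrable setT (EFin \o (fun x => u (pi x))).
Proof.
move=> [mu [M uM]]; split; apply: (@bounded_integrable _ _ _ _ _ M) => //.
- exact: (measurableT_comp mu measurable_lpi_shift).
- exact: (measurableT_comp mu measurable_lpi).
Qed.

Lemma driftD u v a k : bounded_mfun u -> bounded_mfun v ->
  drift (fun q => u q + a * v q) k = drift u k + a * drift v k.
Proof.
move=> bu bv; have [iu iu'] := integrable_bounded_mfun (th k) bu.
have [iv iv'] := integrable_bounded_mfun (th k) bv.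
rewrite /drift !RintegralD//; first last.
- exact: (integrableZl measurableT a iv).
- exact: (integrableZl measurableT a iv').
by rewrite !RintegralZl//; ring.
Qed.

Lemma bounded_mfun_indic B : measurable B -> bounded_mfun (\1_B).
Proof.
move=> mB; split; first exact: measurable_indic.
by exists 1 => q; rewrite indicE; case: (_ \in _); rewrite ?normr1 ?normr0.
Qed.

Lemma drift_indic B k : measurable B -> drift (\1_B) k =
  fine (th k [set x | B (pi (g * (x : G))%g)]) - fine (th k [set x | B (pi x)]).
Proof.
move=> mB.
have RI (A : set (borel G)) : measurable A -> \int[th k]_x \1_A x = fine (th k A).
  by move=> mA; rewrite /Rintegral integral_indic ?setIT.
congr (_ - _).
- apply: (RI [set x | B (pi (g * (x : G))%g)]); rewrite -[X in measurable X]setTI.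
  exact: (measurable_lpi_shift measurableT mB).
- apply: (RI [set x | B (pi x)]); rewrite -[X in measurable X]setTI.
  exact: (measurable_lpi measurableT mB).
Qed.

Lemma bounded_mfunD u v a : bounded_mfun u -> bounded_mfun v ->
  bounded_mfun (fun q => u q + a * v q).
Proof.
move=> [mu [M uM]] [mv [N vN]]; split.
  by apply: measurable_funD => //; apply: measurable_funM.
exists (M + `|a| * N) => q; rewrite (le_trans (ler_normD _ _))// lerD//.
by rewrite normrM ler_wpM2l.
Qed.

(** A bounded measurable function is a uniform limit of linear combinations of
    indicators of its superlevel sets B j. *)
Lemma drift_cvg0 u : bounded_mfun u -> drift u k @[k --> \oo] --> (0 : R).
Proof.
move=> bu; have [mu [M0 uM0]] := bu.
pose M := `|M0| + 1.
have M1 : 0 < M by rewrite ltr_wpDl.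
have uM q : `|u q| <= M.
  by rewrite (le_trans (uM0 q))// (le_trans (ler_norm _))// lerDl.
apply/cvgrPdist_le => e e0.
have e2 : 0 < e / 3 / (2 * M) by rewrite !divr_gt0// mulr_gt0.
have [N Ne] := ex_invS_lt e2.
pose dl := 2 * M / N.+1%:R.
have dl0 : 0 < dl by rewrite divr_gt0// mulr_gt0.
have dle : dl <= e / 3.
  rewrite /dl mulrC -ler_pdivlMr ?mulr_gt0//; exact: ltW.
pose B (j : nat) := [set q : borel Y | j.+1%:R <= (u q + M) / dl].
have mB j : measurable (B j).
  rewrite -[B j]setTI (_ : B j = (fun q => (u q + M) / dl) @^-1` `[j.+1%:R, +oo[).
    by apply: (measurable_funM (measurable_funD mu _) _).
  by apply/seteqP; split=> q; rewrite /B /= in_itv /= andbT.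
pose s n (q : borel Y) : R := - M + dl * \sum_(j < n) \1_(B j) q.
have bs n : bounded_mfun (s n) /\ drift (s n) k @[k --> \oo] --> (0 : R).
  elim: n => [|n [IH1 IH2]].
    have sE : s 0%N = cst (- M).
      by apply/funext => q; rewrite /s big_ord0 mulr0 addr0.
    rewrite sE; split; first by split; [exact: measurable_cst|exists `|- M|].
    rewrite /drift /=; under eq_fun do rewrite subrr; exact: cvg_cst.
  have sE : s n.+1 = (fun q => s n q + dl * \1_(B n) q).
    by apply/funext => q; rewrite /s big_ord_recr /= mulrDr addrA.
  have bB := bounded_mfun_indic (mB n).
  rewrite sE; split; first exact: bounded_mfunD.
  under eq_fun do rewrite driftD//.
  rewrite -(addr0 0) -{2}(mulr0 dl); apply: cvgD => //; apply: cvgM.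
    exact: cvg_cst.
  rewrite (_ : drift (\1_(B n)) = fun k =>
      fine (th k [set x | B n (pi (g * (x : G))%g)]) -
      fine (th k [set x | B n (pi x)])); first exact: th_g (mB n).
  by apply/funext => k; rewrite drift_indic.
have su q : `|u q - s N.+1 q| <= e / 3.
  have y0 : 0 <= (u q + M) / dl.
    by rewrite divr_ge0 ?(ltW dl0)//; have := uM q; rewrite ler_norml; lra.
  have yN : (u q + M) / dl <= N.+1%:R.
    rewrite ler_pdivrMr// /dl mulrC divfK ?pnatr_eq0//.
    by have := uM q; rewrite ler_norml; lra.
  have := (staircase N.+1 y0).2 yN.
  have -> : \sum_(j < N.+1) (j.+1%:R <= (u q + M) / dl)%R%:R =
      \sum_(j < N.+1) \1_(B j) q :> R.
    by apply: eq_bigr => j _; rewrite indicE /B mem_setE.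
  rewrite /s; move: (\sum_(_ < _) _) => S /andP[S1 S2].
  move: S1; rewrite lerBlDr ler_pdivrMr// => S1.
  move: S2; rewrite ler_pdivlMr// => S2.
  by rewrite ler_norml; lra.
have [bsN dsN] := bs N.+1.
have e3 : 0 < e / 3 by rewrite divr_gt0.
move/cvgrPdist_le : dsN => /(_ _ e3); apply: filterS => k.
rewrite !sub0r !normrN => dsk.
have br : bounded_mfun (fun q => u q + (-1) * s N.+1 q) by exact: bounded_mfunD.
have := @driftD u (s N.+1) (-1) k bu bsN.
set r := (fun q => _) in br * => rE.
have rle q : `|r q| <= e / 3 by rewrite /r mulN1r.
have [ir ir'] := integrable_bounded_mfun (th k) br.
have Ile (f : borel G -> R) : (th k).-integrable setT (EFin \o f) ->
    (forall x, `|f x| <= e / 3) -> `|\int[th k]_x f x| <= e / 3.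
  move=> If fe; apply: le_trans (le_normr_Rintegral measurableT If) _.
  have ce : (th k).-integrable setT (EFin \o cst (e / 3)).
    exact: finite_measure_integrable_cst.
  apply: (@le_trans _ _ (\int[th k]_x cst (e / 3) x)).
    by apply: le_Rintegral => //; exact: (integrable_norm If).
  by rewrite /cst Rintegral_cst//= probability_setT mulr1.
have := Ile _ ir (fun x => rle _); have := Ile _ ir' (fun x => rle _).
move: rE; rewrite {1}/drift; move: dsk; rewrite !ler_norml.
by lra.
Qed.

End asymptotic_translation.

Section mean.
Context (R : realType) (G : topGroupType) (U : nat -> set G).
Hypothesis HU : countable_base U.
Variable mu : probability (borel G) R.
Hypothesis mu_null : forall (g : G) (A : set (borel G)), measurable A ->
  mu A = 0%E -> mu [set x | A (g * (x : G))%g] = 0%E.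
Variables (H : closedSubgroup G) (th : nat -> probability (borel G) R).
Notation Y := (lcoset_space H).
Notation pi x := (\pi_Y (x : G)).
Hypothesis th_null : forall k (A : set (borel G)), measurable A ->
  mu A = 0%E -> th k A = 0%E.
Hypothesis th_asymptotic : {ae mu, forall g, forall B : set (borel Y), measurable B ->
  (fine (th k [set x | B (pi ((g : G) * (x : G))%g)]) - fine (th k [set x | B (pi x)]))
    @[k --> \oo] --> (0 : R)}.

Let proj (x : borel G) : borel Y := pi x.
Let proj_measurable : measurable_fun setT proj.
Proof. exact: measurable_lpi. Qed.
HB.instance Definition _ := isMeasurableFun.Build _ _ _ _ proj proj_measurable.
Let nu : probability (borel Y) R := distribution mu proj.

Let nuE (A : set (borel Y)) : nu A = mu [set x | A (pi x)].
Proof. by []. Qed.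

Let measurable_proj (A : set (borel Y)) : measurable A ->
  measurable [set x : borel G | A (pi x)].
Proof.
by move=> mA; rewrite -[X in measurable X]setTI; exact: (proj_measurable measurableT mA).
Qed.

Lemma pi_lactM (g s : G) (q : Y) : lact g (lact s q) = lact (g * s)%g q.
Proof.
by rewrite -[q]reprK (@lact_pi _ H s) (@lact_pi _ H g) (@lact_pi _ H (g * s)%g)
  mulgA.
Qed.

Lemma measurable_lact (g : G) : measurable_fun setT (lact g : borel Y -> borel Y).
Proof.
apply: measurable_borel => A oA; apply: open_borel.
rewrite /open /= /quotient_open.
have -> : \pi_Y @^-1` (lact g @^-1` A) = (fun x : G => (g * x)%g) @^-1` (\pi_Y @^-1` A).
  by apply/seteqP; split=> x; rewrite /preimage /= lact_pi.
have oA' : open ((\pi_Y : G -> Y) @^-1` A) by [].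
apply: open_comp oA' => x _.
have cid : continuous (fun x : G => x) by move=> y; exact: cvg_id.
have cst_ : continuous (fun _ : G => g) by move=> y; exact: cvg_cst.
exact: (continuousM cst_ cid).
Qed.

Lemma nu_lact (g : G) (A : set (borel Y)) : measurable A -> nu A = 0%E ->
  nu (lact g @^-1` A) = 0%E.
Proof.
move=> mA; rewrite !nuE => A0.
have := mu_null g (measurable_proj mA) A0.
by congr (mu _ = _); apply/seteqP; split=> x /=; rewrite lact_pi.
Qed.

Lemma invariant_class_nu : invariant_class nu.
Proof.
split.
- apply/eqP => nu0; have /eqP := etrans (esym (probability_setT nu)) nu0.
  by rewrite onee_eq0.
- exact: sigma_finiteT.
- move=> g A mA; split; last exact: nu_lact.
  have mgA : measurable (lact g @^-1` A : set (borel Y)).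
    by rewrite -[X in measurable X]setTI; exact: (measurable_lact g measurableT mA).
  move=> /(nu_lact g^-1%g mgA).
  congr (nu _ = _); apply/seteqP; split=> q; rewrite /preimage /= pi_lactM mulgV;
    by rewrite -[q]reprK lact_pi mul1g.
Qed.

Definition ess_bounded (f : borel Y -> R) :=
  measurable_fun setT f /\ exists M : R, {ae nu, forall q, `|f q| <= M}.

Lemma LfunooP (f : borel Y -> R) : f \in Lfun nu +oo%E <-> ess_bounded f.
Proof.
have nu0 : (0 < nu setT)%E by rewrite probability_setT lte01.
split.
- move=> fL; have mf : measurable_fun setT f := set_mem (sub_Lfun_mfun fL).
  have : finite_norm nu +oo%E f := set_mem (sub_Lfun_finLfun fL).
  rewrite /finite_norm unlock nu0 => fin; split; first exact: mf.
  have ge0 : (0 <= ess_sup nu (abse \o (EFin \o f)))%E.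
    by apply: ess_sup_gee => //; apply: aeW => q /=.
  exists (fine (ess_sup nu (abse \o (EFin \o f)))).
  have := ess_sup_ge nu (abse \o (EFin \o f)); apply: filterS => q /= fq.
  by rewrite -lee_fin fineK// ge0_fin_numE.
- move=> [mf [M fM]]; apply/andP; split; apply/mem_set => //=.
  rewrite /finite_norm unlock nu0.
  apply: (@le_lt_trans _ _ M%:E); last by rewrite ltry.
  by apply/ess_supP; apply: filterS fM => q fq /=; rewrite lee_fin.
Qed.

Let ae_th k (Q : Y -> Prop) : {ae nu, forall q, Q q} ->
  {ae th k, forall x, Q (pi x)}.
Proof.
move=> [N [mN N0 sub]]; exists [set x : borel G | N (pi x)]; split.
- exact: measurable_proj.
- by apply: th_null; [exact: measurable_proj|exact: N0].
- by move=> x /= nQ; apply: sub.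
Qed.

Definition average k (f : borel Y -> R) : R := \int[th k]_x f (pi x).

Lemma average_ae k f1 f2 : measurable_fun setT f1 -> measurable_fun setT f2 ->
  {ae nu, forall q, f1 q = f2 q} -> average k f1 = average k f2.
Proof.
move=> m1 m2 f12; congr fine; apply: ae_eq_integral => //.
- by apply/measurable_EFinP; exact: (measurableT_comp m1 proj_measurable).
- by apply/measurable_EFinP; exact: (measurableT_comp m2 proj_measurable).
- have FF : Filter (nbhs (almost_everywhere (th k))).
    exact: ae_filter_ringOfSetsType.
  by apply: filterS (ae_th k f12) => x -> _.
Qed.

(** The averages see only the class of f modulo null sets, so that f may be
    truncated to an everywhere bounded function. *)
Lemma ess_bounded_repr f : ess_bounded f ->
  exists2 u, bounded_mfun u & {ae nu, forall q, f q = u q}.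
Proof.
move=> [mf [M fM]].
exists (fun q => Num.max (- `|M|) (Num.min `|M| (f q))).
  split; first by apply: measurable_maxr => //; exact: measurable_minr.
  exists `|M| => q; rewrite ler_norml le_max lexx /= ge_max ge_min lexx /= andbT.
  by rewrite (le_trans _ (normr_ge0 M))// oppr_le0.
apply: filterS fM => q fq; have := le_trans fq (ler_norm M).
by rewrite ler_norml => /andP[f1 f2]; rewrite min_r// max_r.
Qed.

Lemma bounded_ess_bounded u : bounded_mfun u -> ess_bounded u.
Proof. by move=> [mu' [M uM]]; split=> //; exists M; exact: aeW. Qed.

Lemma ess_bounded_lact g f : ess_bounded f -> ess_bounded (f \o lact g).
Proof.
move=> [mf [M fM]]; split.
  exact: (measurableT_comp mf (measurable_lact g)).
exists M; case: fM => N [mN N0 sub]; exists (lact g @^-1` N); split.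
- by rewrite -[X in measurable X]setTI; exact: (measurable_lact g measurableT mN).
- exact: nu_lact.
- by move=> q /= nf; apply: sub.
Qed.

Section limit.
Variable F : set_system nat.
Hypotheses (FU : UltraFilter F) (Foo : \oo `<=` F).

Definition lim_average (f : borel Y -> R) : R := lim (average k f @[k --> F]).

Lemma cvg_average f : ess_bounded f -> average k f @[k --> F] --> lim_average f.
Proof.
move=> bf; have [u bu fu] := ess_bounded_repr bf.
have [mu' [M uM]] := bu.
suff : cvg (average k f @[k --> F]) by [].
apply: (@ultra_cvg _ _ _ M) => // k.
rewrite (average_ae k bf.1 mu' fu).
have [_ iu] := integrable_bounded_mfun HU 1%g (th k) bu.
apply: le_trans (le_normr_Rintegral measurableT iu) _.
have cM : (th k).-integrable setT (EFin \o cst M).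
  exact: finite_measure_integrable_cst.
apply: (@le_trans _ _ (\int[th k]_x cst M x)).
  by apply: le_Rintegral => //; exact: (integrable_norm iu).
by rewrite /cst Rintegral_cst//= probability_setT mulr1.
Qed.

Lemma lim_average_mean : is_mean nu lim_average.
Proof.
have PF : ProperFilter F by exact: ultra_proper.
split.
- move=> f1 f2 /LfunooP b1 /LfunooP b2 f12; congr (lim _).
  have E : average ^~ f1 = average ^~ f2.
    apply/funext => k; apply: average_ae b1.1 b2.1 _.
    by apply: filterS f12 => q /(_ Logic.I).
  by rewrite /fmap E.
- move=> f1 f2 /LfunooP b1 /LfunooP b2 a.
  have [u1 bu1 fu1] := ess_bounded_repr b1.
  have [u2 bu2 fu2] := ess_bounded_repr b2.
  apply/cvg_lim => //.
  have E k : average k (fun q => a * f1 q + f2 q) =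
      a * average k f1 + average k f2.
    rewrite (average_ae k b1.1 bu1.1 fu1) (average_ae k b2.1 bu2.1 fu2).
    rewrite (@average_ae k _ (fun q => a * u1 q + u2 q)).
    + have [_ i1] := integrable_bounded_mfun HU 1%g (th k) bu1.
      have [_ i2] := integrable_bounded_mfun HU 1%g (th k) bu2.
      rewrite /average RintegralD//; last exact: (integrableZl measurableT a i1).
      by rewrite RintegralZl.
    + by apply: measurable_funD b2.1; apply: measurable_funM b1.1.
    + by apply: measurable_funD bu2.1; apply: measurable_funM bu1.1.
    + by apply: filterS2 fu1 fu2 => q -> ->.
  under eq_fun do rewrite E.
  by apply: cvgD; [apply: cvgM; [exact: cvg_cst|]|]; exact: cvg_average.
- move=> f /LfunooP bf f0; have [u bu fu] := ess_bounded_repr bf.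
  apply: limr_ge; first exact: (cvgP _ (cvg_average bf)).
  apply: (@nearW _ F) => k.
  rewrite (@average_ae k f (fun q => `|u q|)).
  + by apply: Rintegral_ge0.
  + exact: bf.1.
  + by apply: measurableT_comp bu.1.
  + by apply: filterS2 f0 fu => q + fuq; rewrite fuq => /ger0_norm.
- apply/cvg_lim => //.
  have -> : average ^~ (fun=> 1) = cst 1.
    by apply/funext => k; rewrite /average Rintegral_cst//= probability_setT mulr1.
  exact: cvg_cst.
Qed.

Lemma lim_average_lact_ae :
  {ae mu, forall g, forall f, ess_bounded f ->
    lim_average (f \o lact g) = lim_average f}.
Proof.
have PF : ProperFilter F by exact: ultra_proper.
have FF : Filter (nbhs (almost_everywhere mu)).
  exact: ae_filter_ringOfSetsType.
apply: filterS th_asymptotic => g thg f bf.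
have [u bu fu] := ess_bounded_repr bf.
have bug := ess_bounded_lact g (bounded_ess_bounded bu).
have bfg := ess_bounded_lact g bf.
have fug : {ae nu, forall q, (f \o lact g) q = (u \o lact g) q}.
  case: fu => N [mN N0 sub]; exists (lact g @^-1` N); split.
  - by rewrite -[X in measurable X]setTI; exact: (measurable_lact g measurableT mN).
  - exact: nu_lact.
  - by move=> q /= nf; apply: sub.
have dE k : drift th g u k = average k (f \o lact g) - average k f.
  rewrite (average_ae k bfg.1 bug.1 fug) (average_ae k bf.1 bu.1 fu).
  by congr (_ - _); apply: eq_Rintegral => x _; rewrite /= lact_pi.
have d0 : drift th g u k @[k --> F] --> (0 : R).
  exact: cvg_trans (cvg_app _ Foo) (drift_cvg0 HU thg bu).
have d1 : drift th g u k @[k --> F] --> lim_average (f \o lact g) - lim_average f.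
  by under eq_fun do rewrite dE; apply: cvgB; exact: cvg_average.
by apply/eqP; rewrite -subr_eq0; apply/eqP; exact: (cvg_unique _ d1 d0).
Qed.

(** Almost every s satisfies the invariance, and so does g s for almost every s,
    as mu is quasi-invariant; hence g satisfies it. *)
Lemma lim_average_lact g f :
  ess_bounded f -> lim_average (f \o lact g) = lim_average f.
Proof.
move=> bf; have [N [mN N0 sub]] := lim_average_lact_ae.
have [s [Ns Ngs]] : exists s : G, ~ N s /\ ~ N (g * s)%g.
  apply: contrapT => /forallNP no.
  have gN0 := mu_null g mN N0.
  have mgN : measurable [set x : borel G | N (g * (x : G))%g].
    by rewrite -[X in measurable X]setTI; exact: (measurable_lmulg HU g measurableT mN).
  have NT : N `|` [set x : borel G | N (g * (x : G))%g] = setT.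
    apply/seteqP; split=> // x _; apply: contrapT => /not_orP[nx ngx].
    by apply: (no x).
  have := probability_setT mu; rewrite -NT.
  have -> : mu (N `|` [set x : borel G | N (g * (x : G))%g]) = 0%E.
    exact: (etrans (measureU0 mN mgN gN0) N0).
  by move=> /esym/eqP; rewrite onee_eq0.
have inv t : ~ N t -> forall f, ess_bounded f ->
    lim_average (f \o lact t) = lim_average f.
  by move=> nN; apply: contrapT => nf; apply: nN; exact: sub.
rewrite -(inv s Ns _ (ess_bounded_lact g bf)) -(inv _ Ngs _ bf).
by congr lim_average; apply/funext => q /=; rewrite pi_lactM.
Qed.

End limit.

Lemma coamenable_of_averages : coamenable R H.
Proof.
exists nu; split; first exact: invariant_class_nu.
have [F [FU Foo]] := @ultraFilterLemma nat \oo _.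
exists (lim_average F); split; first exact: lim_average_mean.
by move=> f /LfunooP bf g; exact: lim_average_lact.
Qed.

End mean.

(** * Triviality of the boundary implies co-amenability *)

Theorem theorem3 (R : realType) (G : topGroupType)
  (G_hausdorff : hausdorff_space G)
  (G_locally_compact : locally_compact [set: G])
  (G_second_countable : @second_countable G)
  (haar : {measure set (borel G) -> \bar R})
  (haar_left : is_left_haar haar)
  (mu : probability (borel G) R)
  (mu_haar : equivalent_measures mu haar)
  (dW : measure_display) (W : measurableType dW) (PW : probability W R)
  (h : nat -> {mfun W >-> borel G})
  (h_iid : is_iid PW mu h)
  (d : measure_display) (T : measurableType d) (P : probability T R)
  (K : {mfun T >-> borel (closedSubgroup G)})
  (K_IRS : is_IRS P K) :
  (\forall w \ae P, trivial_boundary (K w) PW h) ->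
  \forall w \ae P, coamenable R (K w).
Proof.
move=> K_trivial.
have [U HU] := second_countable_base G_second_countable.
have mu_null : forall (g : G) (A : set (borel G)), measurable A ->
    mu A = 0%E -> mu [set x | A (g * (x : G))%g] = 0%E.
  move: mu_haar haar_left => [/null_content_dominatesP mh /null_content_dominatesP hm].
  move=> [_ _ invH] g A mA A0.
  have mgA : measurable [set x : borel G | A (g * (x : G))%g].
    by rewrite -[X in measurable X]setTI; exact: (measurable_lmulg HU g measurableT mA).
  apply: mh => //; have := invH g^-1%g A mA; rewrite (hm A mA A0) => <-.
  congr (haar _); apply/seteqP; split=> x /=.
    by move=> Ax; exists (g * (x : G))%g => //; rewrite mulgA mulVg mul1g.
  by move=> [y Ay <-]; rewrite mulgA mulgV mul1g.
(* K' is K, as a map to the coarser sigma-algebra generated by the hitting sets. *)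
pose K' (w : T) : subG G := K w.
have mK : measurable_fun setT K'.
  move=> _ A mA.
  exact: (@measurable_funPT _ _ _ _ K measurableT A (borel_hits mA)).
have K_inv (y : G) (A : set (subG G)) : measurable A ->
    P [set w | A (csg_conj y (K' w))] = P [set w | A (K' w)].
  by move=> /borel_hits mA; exact: (K_IRS y A mA).
have [n Hn] := summable_defects HU h_iid mu_null mK K_inv K_trivial.
apply: filterS Hn => w Hw.
apply: (coamenable_of_averages HU mu_null (th := fun k => cesaro HU PW h (n k))).
  by move=> k A mA A0; exact: (cesaro_null HU h_iid mu_null).
have FF : Filter (nbhs (almost_everywhere mu)).
  exact: ae_filter_ringOfSetsType.
apply: filterS Hw => g Hg.
have small e : 0 < e ->
    \forall k \near \oo, (total_defect HU PW h (n k) g (K' w) <= e%:E)%E.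
  move=> e0; have tl := nneseries_tail_cvg Hg
    (fun k _ => total_defect_ge0 HU PW h (n k) g (K' w)).
  have /fine_cvgP[fin /cvgrPdist_le /(_ e e0) tle] := tl.
  apply: filterS2 fin tle => k fk; rewrite sub0r normrN => tk.
  apply: (@le_trans _ _ (\sum_(k <= i <oo) total_defect HU PW h (n i) g (K' w))%E).
    have := @nneseries_lim_ge R (fun i => total_defect HU PW h (n i) g (K' w))
      predT k k.+1 (fun i _ _ => total_defect_ge0 HU PW h (n i) g (K' w)).
    by rewrite big_nat1.
  by rewrite -(fineK fk) lee_fin (le_trans (ler_norm _)).
move=> B mB; apply/cvgrPdist_le => e e0.
have e2 : 0 < e / 2 by rewrite divr_gt0.
apply: filterS (small _ e2) => k tk; rewrite sub0r normrN.
pose th := cesaro HU PW h (n k).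
(* Applied to a set and to its complement, this bounds the absolute value. *)
have bound (A : set (borel (lcoset_space (K w)))) : measurable A ->
    fine (th [set x : borel G | A (\pi_(lcoset_space (K w)) ((g : G) * (x : G))%g)]) -
    fine (th [set x : borel G | A (\pi_(lcoset_space (K w)) (x : G))]) <= e.
  move=> mA; have [m /le_trans] := translate_le_defect HU th g mA e2; apply.
  rewrite [e in leRHS]splitr lerD2r -lee_fin.
  exact: le_trans (defect_le_total HU PW h (n k) g m (K' w)) tk.
have mp (A : set (borel (lcoset_space (K w)))) : measurable A ->
    measurable [set x : borel G | A (\pi_(lcoset_space (K w)) ((g : G) * (x : G))%g)] /\
    measurable [set x : borel G | A (\pi_(lcoset_space (K w)) (x : G))].
  move=> mA; split; rewrite -[X in measurable X]setTI.
    exact: (@measurable_lpi_shift _ _ HU (K w) g measurableT A mA).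
  exact: (@measurable_lpi _ (K w) measurableT A mA).
have [m1 m2] := mp B mB.
have fC (A : set (borel G)) : measurable A -> fine (th (~` A)) = 1 - fine (th A).
  move=> mA; transitivity (fine (1 - th A)%E).
    by congr fine; exact: (probability_setC th mA).
  by rewrite fineB ?fin_num_measure.
have := bound _ (measurableC mB); have := bound B mB.
rewrite -[[set x | (~` B) (\pi_(lcoset_space (K w)) (x : G))]]/(~` [set x : borel G |
  B (\pi_(lcoset_space (K w)) (x : G))]) (fC _ m2).
rewrite -[[set x | (~` B) _]]/(~` [set x : borel G |
  B (\pi_(lcoset_space (K w)) ((g : G) * (x : G))%g)]) (fC _ m1).
by rewrite ler_norml; lra.
Qed.
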